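(* There exists a set $E\subset\mathbb{R}^2$ such that $0<\mathcal{H}^1(E)<\infty$, $E$ is purely $1$-unrectifiable, and, for every $p$ with $1\leq p<2$, $$\int_0^1\beta_{\mathcal{H}^1|_E,p}^1(x,r)^2\,\frac{dr}{r}<\infty\quad\text{for }\mathcal{H}^1\text{-a.e. }x\in E.$$
   Context: $\mathcal{H}^1$ denotes $1$-dimensional Hausdorff measure and $\mathcal{H}^1|_E$ its restriction to $E$. For a measure $\mu$ in $\mathbb{R}^2$, $1\leq p<\infty$, $x\in\mathbb{R}^2$ and $r>0$, with $B(x,r)$ the ball of center $x$ and radius $r$, define $$\beta_{\mu,p}^1(x,r)=\inf_{L\subset\mathbb{R}^2\text{ a line}}\left(\int_{B(x,r)}\left(\frac{\operatorname{dist}(y,L)}{r}\right)^p\,\frac{d\mu(y)}{r}\right)^{1/p},$$ where the infimum is over all (affine) lines. A Radon measure $\mu$ in $\mathbb{R}^2$ is $1$-rectifiable if there are Lipschitz maps $f_i:\mathbb{R}\to\mathbb{R}^2$, $i=1,2,\ldots$, such that $\mu(\mathbb{R}^2\setminus\bigcup_i f_i(\mathbb{R}))=0$, and $\mu$ is absolutely continuous with respect to $\mathcal{H}^1$. A set $F\subset\mathbb{R}^2$ is $1$-rectifiable if the measure $\mathcal{H}^1|_F$ is $1$-rectifiable. A set $E$ is purely $1$-unrectifiable if every $1$-rectifiable subset $F\subset E$ satisfies $\mathcal{H}^1(F)=0$. *)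

(* Defs.v *)
From HB Require Import structures.
From mathcomp Require Import all_boot all_order all_algebra.
From mathcomp Require Import all_classical all_reals all_analysis.

Set Implicit Arguments.
Unset Strict Implicit.
Unset Printing Implicit Defensive.

Import Order.TTheory GRing.Theory Num.Theory.
Import numFieldNormedType.Exports.

Local Open Scope classical_set_scope.
Local Open Scope ring_scope.

(* The library norm on ['rV[R]_2] is the sup norm; the metric notions below
   use the Euclidean norm instead. Both induce the same topology, so [open] and
   [compact] are the usual ones. *)
Notation plane R := 'rV[R]_2.

Section euclidean.
Context {R : realType}.
Implicit Types (x y : plane R) (L A : set (plane R)).

Definition enorm x : R := Num.sqrt (\sum_(i < 2) x ord0 i ^+ 2).

Definition edist x y : R := enorm (x - y).

Definition eball x (r : R) : set (plane R) := [set y | edist x y < r].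

Definition is_line L := exists a v : plane R,
  v != 0 /\ L = [set a + t *: v | t in [set: R]].

Definition dist_set y L : R := inf [set edist y z | z in L].

(* The point [0] is adjoined only to give the empty set diameter [0]. *)
Definition diam A : \bar R :=
  ereal_sup ([set 0%E] `|` [set (edist x y)%:E | x in A & y in A]).

Definition lipschitz_curve (f : R -> plane R) :=
  exists k : R, forall s t : R, edist (f s) (f t) <= k * `|s - t|.

End euclidean.

Section hausdorff_measure.
Context {R : realType}.
Local Open Scope ereal_scope.
Implicit Types (A : set (plane R)) (U : (set (plane R))^nat).

Definition delta_cover (delta : R) A : set ((set (plane R))^nat) :=
  [set U | (forall k, diam (U k) <= delta%:E) /\ A `<=` \bigcup_k U k].

Definition hausdorff1_delta (delta : R) A : \bar R :=
  ereal_inf [set \sum_(k <oo) diam (U k) | U in delta_cover delta A].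

Definition hausdorff1 A : \bar R :=
  ereal_sup [set hausdorff1_delta delta A | delta in [set d : R | (0 < d)%R]].

Lemma diam_ge0 A : 0 <= diam A.
Proof. by apply: ereal_sup_ubound; left. Qed.

Lemma diam0 : diam (set0 : set (plane R)) = 0.
Proof.
apply/eqP; rewrite eq_le diam_ge0 andbT; apply: ge_ereal_sup => y [->//|].
by move=> [x].
Qed.

Lemma hausdorff1_delta_ge0 delta A : 0 <= hausdorff1_delta delta A.
Proof.
apply: le_ereal_inf_tmp => _ [U _ <-].
by apply: nneseries_ge0 => k _ _; exact: diam_ge0.
Qed.

Lemma hausdorff1_delta0 delta : (0 < delta)%R -> hausdorff1_delta delta set0 = 0.
Proof.
move=> d0; apply/eqP; rewrite eq_le hausdorff1_delta_ge0 andbT.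
apply: ereal_inf_lbound; exists (fun=> set0).
  by split=> // k; rewrite diam0 lee_fin ltW.
by rewrite eseries0 // => k _ _; rewrite diam0.
Qed.

Lemma le_hausdorff1_delta delta :
  {homo hausdorff1_delta delta : A B / A `<=` B >-> A <= B}.
Proof.
move=> A B AB; apply/ereal_inf_le_tmp => _ [U [dU BU] <-].
by exists U => //; split=> //; exact: subset_trans BU.
Qed.

Lemma hausdorff1_delta_sigma_subadditive delta :
  sigma_subadditive (hausdorff1_delta delta).
Proof.
set mu := hausdorff1_delta delta => A.
have mu_ge0 := hausdorff1_delta_ge0 delta.
have [[i ioo]|] := pselect (exists i, mu (A i) = +oo).
  by rewrite (eseries_pinfty _ _ ioo) ?leey// => n _; rewrite -ltNye (lt_le_trans _ (mu_ge0 _)).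
rewrite -forallNE => Aoo.
suff add2e (e : {posnum R}) :
    mu (\bigcup_n A n) <= \sum_(i <oo) mu (A i) + e%:num%:E.
  by apply/lee_addgt0Pr => _/posnumP[].
rewrite (le_trans _ (epsilon_trick _ _ _))//.
pose P n (B : (set (plane R))^nat) := delta_cover delta (A n) B /\
  \sum_(k <oo) diam (B k) <= mu (A n) + (e%:num / (2 ^ n.+1)%:R)%:E.
have [G PG] : {G : ((set (plane R))^nat)^nat & forall n, P n (G n)}.
  apply: (@choice _ _ P) => n; rewrite /P.
  have en1 : (0 < e%:num / (2 ^ n.+1)%:R)%R by [].
  have finmu : mu (A n) \is a fin_num.
    by rewrite ge0_fin_numE ?mu_ge0// ltey; apply/eqP; exact: Aoo.
  have [_ [B AB <-] lt] := lb_ereal_inf_adherent en1 finmu.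
  by exists B; split => //; exact: ltW.
have dG_ge0 x : 0 <= (diam \o uncurry G) x by exact: diam_ge0.
apply: (@le_trans _ _ (\esum_(i in setT) (diam \o uncurry G) i)).
  apply: ereal_inf_lbound => /=.
  have /card_esym/ppcard_eqP[f] := card_nat2.
  exists (uncurry G \o f).
    split => [i|]; first by rewrite /=; case: (f i) => a b; have [[dG _] _] := PG a; exact: dG.
    move=> t [i _ Ait]; have [[_ cG] _] := PG i; have [j _ Gt] := cG t Ait.
    by exists (f^-1%FUN (i, j)) => //=; rewrite invK ?inE.
  rewrite -(esum_pred_image (diam \o uncurry G) _ xpredT) ?[fun=> _]set_true//.
  by rewrite image_eq.
rewrite (_ : esum _ _ = \sum_(i <oo) \sum_(j <oo ) diam (G i j)); last first.
  pose J : nat -> set (nat * nat) := fun i => [set (i, j) | j in setT].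
  rewrite (_ : setT = \bigcup_k J k); last first.
    by rewrite predeqE => -[a b]; split => // _; exists a => //; exists b.
  rewrite esum_bigcupT /=; last 2 first.
    - apply/trivIsetP => i j _ _ ij.
      rewrite predeqE => -[n m] /=; split => //= -[] [_] _ [<-{n} _].
      by move=> [m' _] [] /esym/eqP; rewrite (negbTE ij).
    - by move=> ?; exact: dG_ge0.
  rewrite -(image_id [set: nat]) -fun_true esum_pred_image//; last first.
    by move=> n _; apply: esum_ge0 => ? _; exact: diam_ge0.
  apply: eq_eseriesr => /= j _.
  rewrite -(esum_pred_image (diam \o uncurry G) (pair j) predT)//=; last 2 first.
    by move=> ? _; exact: diam_ge0.
    by move=> ? ? _ _; exact: (@can_inj _ _ _ snd).
  by congr esum; rewrite predeqE => -[a b]; split; move=> [i _ <-]; exists i.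
apply: lee_nneseries => [n _ _|n _]; last exact: (PG n).2.
by apply: nneseries_ge0 => m *; exact: diam_ge0.
Qed.

Lemma hausdorff1_delta_le delta A :
  (0 < delta)%R -> hausdorff1_delta delta A <= hausdorff1 A.
Proof. by move=> d0; apply: ereal_sup_ubound; exists delta. Qed.

Lemma hausdorff1_0 : hausdorff1 set0 = 0.
Proof.
apply/eqP; rewrite eq_le; apply/andP; split.
  by apply: ge_ereal_sup => _ [d /= d0 <-]; rewrite hausdorff1_delta0.
exact: le_trans (hausdorff1_delta_ge0 1 _) (hausdorff1_delta_le _ ltr01).
Qed.

Lemma hausdorff1_ge0 A : 0 <= hausdorff1 A.
Proof. exact: le_trans (hausdorff1_delta_ge0 1 _) (hausdorff1_delta_le _ ltr01). Qed.

Lemma le_hausdorff1 : {homo hausdorff1 : A B / A `<=` B >-> A <= B}.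
Proof.
move=> A B AB; apply: ge_ereal_sup => _ [d /= d0 <-].
by apply: (le_trans _ (hausdorff1_delta_le B d0)); exact: le_hausdorff1_delta.
Qed.

Lemma hausdorff1_sigma_subadditive : sigma_subadditive hausdorff1.
Proof.
move=> A; apply: ge_ereal_sup => _ [d /= d0 <-].
rewrite (le_trans (hausdorff1_delta_sigma_subadditive _ _))//.
apply: lee_nneseries => [n _ _|n _]; first exact: hausdorff1_delta_ge0.
exact: hausdorff1_delta_le.
Qed.

HB.instance Definition _ := isOuterMeasure.Build R (plane R) hausdorff1
  hausdorff1_0 hausdorff1_ge0 le_hausdorff1 hausdorff1_sigma_subadditive.

End hausdorff_measure.

Notation H1 R := (@hausdorff1 R : {outer_measure set (plane R) -> \bar R}).

Section outer_restriction.
Context {R : realType} {T : Type}.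
Variables (mu : {outer_measure set T -> \bar R}) (E : set T).
Local Open Scope ereal_scope.

Definition outer_restr (A : set T) : \bar R := mu (A `&` E).

Lemma outer_restr0 : outer_restr set0 = 0.
Proof. by rewrite /outer_restr set0I outer_measure0. Qed.

Lemma outer_restr_ge0 A : 0 <= outer_restr A.
Proof. exact: outer_measure_ge0. Qed.

Lemma le_outer_restr : {homo outer_restr : A B / A `<=` B >-> A <= B}.
Proof. by move=> A B AB; apply: le_outer_measure; exact: setSI. Qed.

Lemma outer_restr_sigma_subadditive : sigma_subadditive outer_restr.
Proof.
by move=> A; rewrite /outer_restr setI_bigcupl; exact: outer_measure_sigma_subadditive.
Qed.

HB.instance Definition _ := isOuterMeasure.Build R T outer_restr
  outer_restr0 outer_restr_ge0 le_outer_restr outer_restr_sigma_subadditive.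

End outer_restriction.

Notation H1_on E :=
  (outer_restr (H1 _) E : {outer_measure set (plane _) -> \bar _}).

(* Measures in the plane are outer measures, as is usual in geometric measure
   theory; to integrate, or to speak of almost every point, one restricts them
   to their Caratheodory-measurable sets. *)
Definition cara_measure {R : realType} (mu : {outer_measure set (plane R) -> \bar R})
    : {measure set (caratheodory_type mu) -> \bar R} :=
  (mu : set (caratheodory_type mu) -> \bar R).

Section beta.
Context {R : realType}.
Local Open Scope ereal_scope.

Definition beta (mu : {outer_measure set (plane R) -> \bar R}) (p : R)
    (x : plane R) (r : R) : \bar R :=
  ereal_inf [set
    (r^-1%:E * \int[cara_measure mu]_(y in eball x r)
                  (((dist_set y L / r) `^ p)%R)%:E) `^ p^-1
    | L in is_line].

End beta.

Section rectifiability.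
Context {R : realType}.
Local Open Scope ereal_scope.
Implicit Types (mu : {outer_measure set (plane R) -> \bar R}) (E F : set (plane R)).

Definition radon_measure mu :=
  [/\ <<s @open (plane R) >> `<=` mu.-caratheodory,
      forall K, compact K -> mu K < +oo,
      forall V, open V ->
        mu V = ereal_sup [set mu K | K in [set K | compact K /\ K `<=` V]] &
      forall A,
        mu A = ereal_inf [set mu V | V in [set V | open V /\ A `<=` V]]].

Definition rectifiable_measure mu :=
  [/\ radon_measure mu,
      exists f : nat -> R -> plane R, (forall i, lipschitz_curve (f i)) /\
        mu (~` \bigcup_i range (f i)) = 0 &
      forall A, H1 R A = 0 -> mu A = 0].

Definition rectifiable_set F := rectifiable_measure (H1_on F).

Definition purely_unrectifiable E :=
  forall F, F `<=` E -> rectifiable_set F -> H1 R F = 0.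

End rectifiability.

(* Main.v *)
From HB Require Import structures.
From mathcomp Require Import all_boot all_order all_algebra.
From mathcomp Require Import all_classical all_reals all_analysis.
From mathcomp Require Import measurable_realfun lebesgue_integral_nonneg.
From mathcomp Require Import ring lra zify.
Require Import Defs.

Set Implicit Arguments.
Unset Strict Implicit.
Unset Printing Implicit Defensive.

Import Order.TTheory GRing.Theory Num.Theory.
Import numFieldNormedType.Exports.

Local Open Scope classical_set_scope.
Local Open Scope ring_scope.

(** The set is the graph of a function on [0, 1[ that jumps at every scale.
    Cut [0, 1[ into cells of generation [k], of length [side k], each of which
    is divided into [nchild k] equal children, with [nchild k] of order [k].
    Starting from the horizontal segment, lift at generation [k] the middle
    child of every cell by [side k], and leave the other children in place.
    What remains in the limit is [fractal]. Three features of the lift matter: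
    its height is comparable to the cell, the proportion [1 / nchild k] of what
    it moves has a divergent sum, and the powers [(1 / nchild k) `^ (2 / p)]
    have a convergent sum exactly when [p < 2].

    The part of the graph over a cell of generation [k] has diameter at most
    [3 * side k], which bounds its measure from above ([H1_fractal_cells]); the
    graph projects onto [0, 1[, which bounds it from below ([H1_fractal_gt0]).

    Pure unrectifiability. A Lipschitz arc that meets the graph both over the
    middle child of a cell and over another child must cross an annulus around
    the lifted piece, and so spends there a time comparable to the length of
    the cell ([split_crossing]). The annuli of all cells of all generations are
    pairwise disjoint ([annulus_disjoint]), hence the cells that the arc splits
    have finite total length ([nsplit_bound]). In every other cell the arc
    misses at least one child out of [nchild k]. As the sum of [1 / nchild k]
    diverges, the cells that the arc meets have total length tending to 0 along
    a sequence of generations, and the arc meets the graph in a set of measure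
    zero ([H1_eq0_of_nsplit]). No differentiation theorem is involved.

    Square function. Let [k] be least with [side k / 4 <= r]. Two points of the
    graph at distance less than [r] have undergone the same lifts before
    generation [k] ([height_near]); take for line the horizontal one at the
    height thus reached. The points of the graph in the ball lie within
    [2 * side k.+1] of it, except those over the middle children, which lie
    within [2 * side k] and have measure at most a constant times
    [r / nchild k]. So the square of the beta number is at most a constant times
    [(nchild k) `^ (- (2 / p)) * (side k / r) ^+ 2] ([beta_fractal_le]), and
    integrating against [dr / r] and summing over [k] gives a finite bound at
    every point of the graph
    ([square_function_fractal]). *)

(** * Coordinates, diameters and separated sets *)

Section coordinates.
Context {R : realType}.
Implicit Types (z w : plane R) (A B : set (plane R)) (i : 'I_2).

Lemma normr_le_enorm z i : `|z ord0 i| <= enorm z.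
Proof.
rewrite /enorm -sqrtr_sqr ler_wsqrtr// (bigD1 i)//= lerDl.
by apply: sumr_ge0 => j _; exact: sqr_ge0.
Qed.

Lemma normr_le_edist z w i : `|z ord0 i - w ord0 i| <= edist z w.
Proof. by have := normr_le_enorm (z - w) i; rewrite !mxE. Qed.

Lemma edist_le z w :
  edist z w <= `|z ord0 ord0 - w ord0 ord0| + `|z ord0 ord_max - w ord0 ord_max|.
Proof.
rewrite /edist /enorm big_ord_recl big_ord1 !mxE.
rewrite (_ : lift ord0 ord0 = ord_max); last exact: val_inj.
set a := z _ _ - _; set b := z _ _ - _.
have ab0 : 0 <= `|a| + `|b| by rewrite addr_ge0.
rewrite -(ger0_norm ab0) -(sqrtr_sqr (`|a| + `|b|)) ler_wsqrtr//.
rewrite -(real_normK (num_real a)) -(real_normK (num_real b)).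
by rewrite sqrrD lerD2r lerDl mulrn_wge0// mulr_ge0.
Qed.

Lemma edist_ge0 z w : 0 <= edist z w.
Proof. exact: sqrtr_ge0. Qed.

Lemma le_diam z w A : A z -> A w -> ((edist z w)%:E <= diam A)%E.
Proof. by move=> Az Aw; apply: ereal_sup_ubound; right; exists z => //; exists w. Qed.

Lemma diam_le A (d : R) : 0 <= d -> (forall z w, A z -> A w -> edist z w <= d) ->
  (diam A <= d%:E)%E.
Proof.
move=> d0 Ad; apply: ge_ereal_sup => _ [->|[z Az [w Aw <-]]]; rewrite lee_fin//.
exact: Ad.
Qed.

Lemma subset_diam A B : A `<=` B -> (diam A <= diam B)%E.
Proof.
move=> AB; apply: ge_ereal_sup => _ [->|[z Az [w Aw <-]]]; first exact: diam_ge0.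
by apply: le_diam; exact: AB.
Qed.

Lemma hausdorff1_delta_anti (d e : R) A : d <= e ->
  (hausdorff1_delta e A <= hausdorff1_delta d A)%E.
Proof.
move=> de; apply: le_ereal_inf_tmp => _ [U [dU AU] <-].
apply: ereal_inf_lbound; exists U => //; split => // k.
by rewrite (le_trans (dU k))// lee_fin.
Qed.

End coordinates.

Section separated.
Context {R : realType}.
Local Open Scope ereal_scope.
Implicit Types (z w : plane R) (A B : set (plane R)) (i : 'I_2).

(** At a scale below the gap [e] no set of a cover meets both [A] and [B], so
    the cover splits into a cover of [A] and a cover of [B]. *)
Lemma hausdorff1_separated i A B (e : R) : (0 < e)%R ->
  (forall z w, A z -> B w -> (z ord0 i + e <= w ord0 i)%R) ->
  H1 R A + H1 R B <= H1 R (A `|` B).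
Proof.
move=> e0 AB.
have key (d : R) : (0 < d < e)%R ->
    hausdorff1_delta d A + hausdorff1_delta d B <= H1 R (A `|` B).
  move=> /andP[d0 de]; apply: le_trans (hausdorff1_delta_le (A `|` B) d0).
  apply: le_ereal_inf_tmp => _ [U [dU ABU] <-].
  have dI (C D : set (plane R)) : diam (C `&` D) <= diam C.
    by apply: subset_diam; exact: subIsetl.
  have cov (C : set (plane R)) : C `<=` A `|` B ->
      hausdorff1_delta d C <= \sum_(k <oo) diam (U k `&` C).
    move=> CAB; apply: ereal_inf_lbound; exists (fun k => U k `&` C) => //.
    split=> [k|z Cz]; first exact: le_trans (dI _ _) (dU k).
    by have [k _ Uz] := ABU z (CAB z Cz); exists k.
  apply: (le_trans (leeD (cov A _) (cov B _))) => //.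
  rewrite -nneseriesD//; try by move=> *; exact: diam_ge0.
  apply: lee_nneseries => k _; first by move=> _; rewrite adde_ge0// diam_ge0.
  have [[z [Uz Az]]|NA] := pselect (exists z, (U k `&` A) z); last first.
    rewrite (_ : U k `&` A = set0) ?diam0 ?add0e//.
    by rewrite -subset0 => z Uz; apply: NA; exists z.
  suff -> : U k `&` B = set0 by rewrite diam0 adde0.
  rewrite -subset0 => w [Uw Bw].
  have := le_trans (le_diam Uz Uw) (dU k); rewrite lee_fin => zw.
  have := normr_le_edist z w i; rewrite distrC.
  have := AB _ _ Az Bw => h1 h2.
  have := ler_norm (w ord0 i - z ord0 i); lra.
have [->|ABoo] := eqVneq (H1 R (A `|` B)) +oo; first exact: leey.
have fin C : C `<=` A `|` B -> H1 R C \is a fin_num.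
  move=> CAB; rewrite ge0_fin_numE ?outer_measure_ge0//.
  by apply: (le_lt_trans (le_outer_measure _ _ _ CAB)); rewrite ltey.
have fA : H1 R A \is a fin_num by exact: fin.
have fB : H1 R B \is a fin_num by exact: fin.
rewrite -leeBrDr//; apply: ge_ereal_sup => _ [d1 /= d10 <-].
rewrite leeBrDr// addeC.
have fA1 : hausdorff1_delta d1 A \is a fin_num.
  rewrite ge0_fin_numE ?hausdorff1_delta_ge0//.
  apply: (le_lt_trans (hausdorff1_delta_le A d10)).
  by rewrite -ge0_fin_numE// hausdorff1_ge0.
rewrite -leeBrDr//; apply: ge_ereal_sup => _ [d2 /= d20 <-].
rewrite leeBrDr// addeC.
pose d := (Num.min (Num.min d1 d2) (e / 2))%R.
have d0 : (0 < d)%R by rewrite !lt_min d10 d20/=; lra.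
apply: le_trans (key d _); last by rewrite d0/= !gt_min; apply/orP; right; lra.
by apply: leeD; apply: hausdorff1_delta_anti; rewrite !ge_min lexx ?orbT.
Qed.

(** Caratheodory's criterion for metric outer measures. The part of the test
    set lying in the half-plane is exhausted by the parts [z ord0 i < s n], each
    separated from the complement. What is left is cut into the strips [T j];
    strips of the same parity are separated from each other, so their measures
    add up to at most that of the test set, and the tails vanish. *)
Lemma halfplane_caratheodory i (a : R) :
  (H1 R).-caratheodory [set z | (z ord0 i < a)%R].
Proof.
apply: le_caratheodory_measurable => X.
set H := [set z | _].
have [->|Xoo] := eqVneq (H1 R X) +oo; first exact: leey.
have fin C : C `<=` X -> H1 R C \is a fin_num.
  move=> CX; rewrite ge0_fin_numE ?outer_measure_ge0//.
  by apply: (le_lt_trans (le_outer_measure _ _ _ CX)); rewrite ltey.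
pose s n : R := (a - n.+1%:R^-1)%R.
have s_lt m n : (m < n)%N -> (s m < s n)%R.
  by move=> mn; rewrite /s ltrD2l ltrN2 ltf_pV2 ?posrE ?ltr_nat// ltr0n.
have s_lta n : (s n < a)%R by rewrite /s ltrBlDr ltrDl invr_gt0 ltr0n.
pose T n := X `&` [set z | (s n <= z ord0 i < s n.+1)%R].
have TX n : T n `<=` X by move=> z [].
have T_sum b n : \sum_(j < n) H1 R (T (j.*2 + b)%N) <= H1 R X.
  apply: (@le_trans _ _ (H1 R (\bigcup_(j < n) T (j.*2 + b)%N))); last first.
    by apply: le_outer_measure => z [j _ []].
  elim: n => [|n IH]; first by rewrite big_ord0 outer_measure_ge0.
  rewrite big_ord_recr/=; apply: le_trans (leeD IH (lexx _)) _.
  set A := \bigcup_(j < n) _; set B := T _.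
  have -> : \bigcup_(j < n.+1) T (j.*2 + b)%N = A `|` B.
    apply/seteqP; split => z.
      move=> [j /= jn Tz]; move: jn; rewrite ltnS leq_eqVlt => /orP[/eqP jn|jn].
        by right; rewrite /B -jn.
      by left; exists j.
    by move=> [[j /= jn Tz]|Bz]; [exists j => //=; exact: ltnW|exists n => /=].
  pose e := (s (n.*2 + b)%N - s (n.*2 + b).-1)%R.
  have [n0|n0] := posnP n.
    rewrite (_ : A = set0); first by rewrite outer_measure0 add0e set0U.
    by rewrite -subset0 => z [j /=]; rewrite n0.
  apply: (@hausdorff1_separated i _ _ e).
    by rewrite subr_gt0 s_lt//; lia.
  move=> z w [j /= jn [_ /= /andP[_ zj]]] [_ /= /andP[wn _]].
  have : (s (j.*2 + b).+1 <= s (n.*2 + b).-1)%R.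
    have: ((j.*2 + b).+1 <= (n.*2 + b).-1)%N by lia.
    by rewrite leq_eqVlt => /orP[/eqP->//|/s_lt/ltW].
  rewrite /e; lra.
have T_cvg b : \sum_(j <oo) H1 R (T (j.*2 + b)%N) < +oo.
  apply: (@le_lt_trans _ _ (H1 R X)); last by rewrite ltey.
  apply: lime_le; first by apply: is_cvg_nneseries => *; exact: outer_measure_ge0.
  by apply: nearW => n /=; rewrite big_mkord T_sum.
have tail b : \sum_(n <= j <oo) H1 R (T (j.*2 + b)%N) @[n --> \oo] --> 0.
  apply: nneseries_tail_cvg; first exact: T_cvg.
  by move=> *; exact: outer_measure_ge0.
apply/lee_addgt0Pr => e e0.
have e20 : (0 < e / 2)%R by lra.
have [n [tail0 tail1]] : exists n,
    \sum_(n <= j <oo) H1 R (T (j.*2 + 0)%N) <= (e / 2)%:E /\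
    \sum_(n <= j <oo) H1 R (T (j.*2 + 1)%N) <= (e / 2)%:E.
  have small b : \forall n \near \oo,
      \sum_(n <= j <oo) H1 R (T (j.*2 + b)%N) <= (e / 2)%:E.
    have /fine_cvgP[fn /cvgr0Pnorm_le /(_ _ e20) le] := tail b.
    near=> n.
    have fs : \sum_(n <= j <oo) H1 R (T (j.*2 + b)%N) \is a fin_num by near: n.
    rewrite -(fineK fs) lee_fin; apply: le_trans (ler_norm _) _.
    by near: n.
  have [n _ hn] := filterI (small 0%N) (small 1%N).
  by exists n; exact: (hn n (leqnn n)).
have XH : H1 R (X `&` H) <= H1 R (X `&` [set z | (z ord0 i < s n.*2)%R]) + e%:E.
  pose U b := \bigcup_(j in ~` `I_n) T (j.*2 + b)%N.
  have UT b : H1 R (U b) <= \sum_(n <= j <oo) H1 R (T (j.*2 + b)%N).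
    exact: (outer_measure_sigma_subadditive_tail _ n (fun j => T (j.*2 + b)%N)).
  apply: (@le_trans _ _ (H1 R ((X `&` [set z | (z ord0 i < s n.*2)%R])
      `|` (U 0%N `|` U 1%N)))).
    apply: le_outer_measure => z [Xz Hz]; rewrite /H/= in Hz.
    have [zs|sz] := ltP (z ord0 i) (s n.*2); first by left.
    right.
    have exk : exists k, (z ord0 i < s k)%R.
      have az : (0 < a - z ord0 i)%R by rewrite subr_gt0.
      exists (Num.truncn (a - z ord0 i)^-1).
      rewrite /s ltrBrDl -ltrBrDr -[ltRHS]invrK ltf_pV2 ?posrE ?ltr0n//.
        exact: truncnS_gt.
      by rewrite invr_gt0.
    case: (ex_minnP exk) => -[|k] zk kmin.
      exfalso; have : (s 0%N <= s n.*2)%R.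
        by have := leq0n n.*2; rewrite leq_eqVlt => /orP[/eqP<-//|/s_lt/ltW].
      lra.
    have zk' : (s k <= z ord0 i)%R.
      by rewrite leNgt; apply/negP => /kmin; rewrite ltnn.
    have nk : (n.*2 <= k)%N.
      rewrite leqNgt; apply/negP => kn.
      have : (s k.+1 <= s n.*2)%R.
        by move: kn; rewrite leq_eqVlt => /orP[/eqP->//|/s_lt/ltW].
      lra.
    have Tk : T k z by split => //=; rewrite zk' zk.
    have nk2 : (n <= k./2)%N by rewrite -(doubleK n) half_leq.
    have kn2 : (~` `I_n) k./2 by move=> /=; rewrite ltnNge nk2.
    have := odd_double_half k; case: (odd k) => [kE|kE].
      by right; exists k./2 => //; rewrite addnC kE.
    by left; exists k./2 => //; rewrite addnC kE.
  apply: le_trans (outer_measureU2 _ _ _) _; apply: leeD => //.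
  apply: le_trans (outer_measureU2 _ _ _) _.
  have -> : e%:E = (e / 2)%:E + (e / 2)%:E by rewrite -EFinD -splitr.
  by apply: leeD; [exact: le_trans (UT 0%N) tail0|exact: le_trans (UT 1%N) tail1].
apply: le_trans (leeD XH (lexx _)) _.
rewrite addeAC leeD2r//.
apply: le_trans (@hausdorff1_separated i _ _ (a - s n.*2) _ _) _.
- by rewrite subr_gt0.
- by move=> z w [_ /= zs] [_ /negP /=]; rewrite -leNgt; lra.
- by apply: le_outer_measure => z [[]|[]].
Unshelve. all: end_near. Qed.

End separated.

(** * Cells, lifts and heights *)

(** Even, so that the middle child starts at the centre of its parent; linear,
    so that the sum of the inverses diverges; at least 64, so that later
    generations are negligible with respect to the current one. *)
Definition nchild k : nat := (2 * (k + 32))%N.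
Definition mid k : nat := (k + 32)%N.
Definition ncell k : nat := (\prod_(j < k) nchild j)%N.

Lemma nchild_gt0 k : (0 < nchild k)%N.
Proof. by rewrite /nchild; lia. Qed.

Lemma ncellS k : ncell k.+1 = (ncell k * nchild k)%N.
Proof. by rewrite /ncell big_ord_recr. Qed.

Lemma ncell_gt0 k : (0 < ncell k)%N.
Proof. by apply: prodn_gt0 => j; exact: nchild_gt0. Qed.

Section cells.
Context {R : realType}.
Implicit Types (x y : R).

Definition side k : R := (ncell k)%:R^-1.
Definition cell k x : nat := Num.truncn (x * (ncell k)%:R).
(** The cell of [x] in generation [k.+1] is the middle child of its cell in
    generation [k]. *)
Definition lifted k x : bool := (cell k.+1 x %% nchild k == mid k)%N.
Definition height k x : R := \sum_(j < k) (lifted j x)%:R * side j.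

Lemma side_gt0 k : 0 < side k.
Proof. by rewrite invr_gt0 ltr0n ncell_gt0. Qed.

Lemma sideS k : side k.+1 * (nchild k)%:R = side k.
Proof.
rewrite /side ncellS natrM invfM -mulrA mulVf ?mulr1//.
by rewrite pnatr_eq0 -lt0n nchild_gt0.
Qed.

Lemma side0 : side 0 = 1.
Proof. by rewrite /side /ncell big_ord0 invr1. Qed.

Lemma side_small k : 64 * side k.+1 <= side k.
Proof.
rewrite -(sideS k) mulrC ler_pM2l ?side_gt0// ler_nat /nchild; lia.
Qed.

Lemma side_anti j k : (j <= k)%N -> side k <= side j.
Proof.
move=> /subnK <-; elim: (k - j)%N => [//|n IH]; rewrite addSn.
apply: le_trans IH; have := side_small (n + j); have := side_gt0 (n + j).+1; lra.
Qed.

Lemma side_le_eps (e : R) : 0 < e -> exists k0, forall k, (k0 <= k)%N -> side k <= e.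
Proof.
move=> e0; exists (Num.truncn e^-1).+1 => k k0k.
apply: le_trans (side_anti k0k) _.
have nk n : (n <= ncell n)%N.
  elim: n => [|n IH]; first by rewrite leq0n.
  by rewrite ncellS /nchild; have := ncell_gt0 n; nia.
rewrite /side -[leRHS]invrK lef_pV2 ?posrE ?invr_gt0 ?ltr0n ?ncell_gt0//.
by apply: le_trans (ltW (truncnS_gt _)) _; rewrite ler_nat.
Qed.

Lemma cell_def k x i : i%:R * side k <= x < i.+1%:R * side k -> cell k x = i.
Proof.
move=> /andP[h1 h2]; apply: truncn_def.
by rewrite -ler_pdivrMr ?ltr0n ?ncell_gt0// -ltr_pdivlMr ?ltr0n ?ncell_gt0// h1 h2.
Qed.

Lemma cell_itv k x : 0 <= x ->
  (cell k x)%:R * side k <= x < (cell k x).+1%:R * side k.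
Proof.
move=> x0; have /truncn_itv : 0 <= x * (ncell k)%:R by rewrite mulr_ge0.
by rewrite -ler_pdivrMr ?ltr0n ?ncell_gt0// -ltr_pdivlMr ?ltr0n ?ncell_gt0.
Qed.

Lemma cell_lt k x : 0 <= x < 1 -> (cell k x < ncell k)%N.
Proof.
move=> /andP[x0 x1]; rewrite truncn_lt_nat ?mulr_ge0//.
by rewrite gtr_pMl// ltr0n ncell_gt0.
Qed.

Lemma cell_parent k x : 0 <= x -> cell k x = (cell k.+1 x %/ nchild k)%N.
Proof.
move=> x0; have /andP[] := cell_itv k.+1 x0.
set i := cell k.+1 x => h1 h2; apply: cell_def; rewrite -sideS.
have c0 := side_gt0 k.+1.
rewrite mulrCA mulrC [X in _ <= x < X]mulrCA [X in _ <= x < X]mulrC -!natrM.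
apply/andP; split.
  by apply: le_trans h1; rewrite ler_pM2r// ler_nat leq_trunc_div.
apply: (lt_le_trans h2); rewrite ler_pM2r// ler_nat.
by rewrite ltn_ceil// nchild_gt0.
Qed.

Lemma cell_child k x : 0 <= x ->
  cell k.+1 x = (cell k x * nchild k + cell k.+1 x %% nchild k)%N.
Proof. by move=> x0; rewrite {1}(divn_eq (cell k.+1 x) (nchild k)) -cell_parent. Qed.

Lemma cell_anc k n x : 0 <= x ->
  cell k x = (cell (k + n) x %/ (\prod_(k <= j < k + n) nchild j))%N.
Proof.
move=> x0; elim: n => [|n IH]; first by rewrite addn0 big_geq// divn1.
rewrite IH addnS big_nat_recr ?leq_addr//= cell_parent// -divnMA mulnC.
by [].
Qed.

Lemma cell_eq_le j k x y : 0 <= x -> 0 <= y -> (j <= k)%N ->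
  cell k x = cell k y -> cell j x = cell j y.
Proof.
move=> x0 y0 jk; rewrite -(subnKC jk) (cell_anc j (k - j) x0) => ->.
by rewrite -cell_anc.
Qed.

Lemma heightS k x : height k.+1 x = height k x + (lifted k x)%:R * side k.
Proof. by rewrite /height big_ord_recr. Qed.

Lemma height_eq k x y : 0 <= x -> 0 <= y -> cell k x = cell k y ->
  height k x = height k y.
Proof.
move=> x0 y0 xy; apply: eq_bigr => j _.
by rewrite /lifted (cell_eq_le x0 y0 (ltn_ord j) xy).
Qed.

Lemma height_cell k x : 0 <= x -> height k ((cell k x)%:R * side k) = height k x.
Proof.
move=> x0; apply: height_eq => //.
  by rewrite mulr_ge0// ltW// side_gt0.
by apply/cell_def; rewrite lexx ltr_pM2r ?side_gt0// ltr_nat ltnSn.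
Qed.

(** The intervals [height k x, height k x + 2 * side k] are nested: the lift by
    [side k] and twice the next, much smaller, side fit within [2 * side k]. *)
Lemma height_itv j k x : (j <= k)%N ->
  height j x <= height k x <= height j x + 2 * side j - 2 * side k.
Proof.
move=> /subnK <-; elim: (k - j)%N => [|n IH]; first by rewrite add0n lexx/=; lra.
rewrite addSn heightS; set d := (lifted _ _)%:R * _.
have d0 : 0 <= d by rewrite mulr_ge0// ltW// side_gt0.
have d1 : d <= side (n + j).
  by rewrite /d; case: (lifted _ _); rewrite ?mul1r// mul0r ltW// side_gt0.
have := side_small (n + j); have := side_gt0 (n + j).+1.
by move: IH => /andP[]; lra.
Qed.

Lemma lifted_near_center k x : 0 <= x -> lifted k x ->
  0 <= x - ((cell k x)%:R + 2^-1) * side k <= side k.+1.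
Proof.
move=> x0 /eqP lx; have := cell_itv k.+1 x0.
rewrite (cell_child k x0) lx -(sideS k) -natr1 natrD natrM.
have -> : (nchild k)%:R = 2 * (mid k)%:R :> R by rewrite -natrM.
have := side_gt0 k.+1; move: (side k.+1) (cell k x)%:R (mid k)%:R => a b c.
nra.
Qed.

End cells.

(** * The set and the upper bound for its measure *)

Section fractal.
Context {R : realType}.
Implicit Types (z w : plane R).

(** The graph of [x |-> \sum_k (lifted k x)%:R * side k], written as a countable
    intersection of conditions on finitely many cells: in this form it is
    visibly a Borel set, and no limit has to be taken. *)
Definition fractal : set (plane R) := [set z | 0 <= z ord0 ord0 < 1 /\
  forall k, height k (z ord0 ord0) <= z ord0 ord_max
            <= height k (z ord0 ord0) + 2 * side k].

Lemma fractal_ge0 z : fractal z -> 0 <= z ord0 ord0.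
Proof. by move=> [/andP[]]. Qed.

Lemma fractal_cell_edist k z w : fractal z -> fractal w ->
  cell k (z ord0 ord0) = cell k (w ord0 ord0) -> edist z w <= 3 * side k.
Proof.
move=> Ez Ew zw; apply: (le_trans (edist_le z w)).
have z0 := fractal_ge0 Ez; have w0 := fractal_ge0 Ew.
have /andP[z1 z2] := cell_itv k z0; have /andP[w1 w2] := cell_itv k w0.
have /andP[z3 z4] := Ez.2 k; have /andP[w3 w4] := Ew.2 k.
have hzw := height_eq z0 w0 zw.
have h1 : `|z ord0 ord0 - w ord0 ord0| <= side k.
  rewrite ler_norml; rewrite zw -natr1 in z1 z2 w1 w2.
  apply/andP; split; lra.
have h2 : `|z ord0 ord_max - w ord0 ord_max| <= 2 * side k.
  by rewrite ler_norml; rewrite hzw in z3 z4; apply/andP; split; lra.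
lra.
Qed.

Local Open Scope ereal_scope.

Lemma hausdorff1_delta_fin_cover (delta d : R) (A : set (plane R)) n
    (U : nat -> set (plane R)) : (0 <= d <= delta)%R ->
  A `<=` \bigcup_(j in `I_n) U j ->
  (forall j z w, U j z -> U j w -> (edist z w <= d)%R) ->
  hausdorff1_delta delta A <= (n%:R * d)%:E.
Proof.
move=> /andP[d0 dd] AU Ud.
pose V j := if (j < n)%N then U j else set0.
have dV j : diam (V j) <= d%:E.
  rewrite /V; case: ifP => _; last by rewrite diam0 lee_fin.
  by apply: diam_le => //; exact: Ud.
apply: (@le_trans _ _ (\sum_(j <oo) diam (V j))).
  apply: ereal_inf_lbound; exists V => //; split=> [j|z /AU[j /= jn Uz]].
    by apply: le_trans (dV j) _; rewrite lee_fin.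
  by exists j => //; rewrite /V jn.
rewrite (nneseries_split _ n); last by move=> *; exact: diam_ge0.
rewrite [X in _ + X]eseries0 ?adde0; last first.
  by move=> k nk _; rewrite /V ltnNge nk/= diam0.
rewrite big_mkord; apply: (@le_trans _ _ (\sum_(j < n) d%:E)).
  by apply: lee_sum => j _; exact: dV.
by rewrite sumEFin lee_fin sumr_const card_ord mulr_natl.
Qed.

(** At every finer generation the cell is a union of descendants whose lengths
    add up to [side k], and over each of them the graph has diameter at most
    three times that length. *)
Lemma H1_fractal_cell k i :
  H1 R (fractal `&` [set z | cell k (z ord0 ord0) = i]) <= (3 * side k)%:E.
Proof.
apply: ge_ereal_sup => _ [delta /= delta0 <-].
have d3 : (0 < delta / 3)%R by rewrite divr_gt0.
have [k0 k0P] := side_le_eps d3.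
pose P := (\prod_(k <= j < k + k0) nchild j)%N.
have P0 : (0 < P)%N by apply: prodn_gt0 => j; exact: nchild_gt0.
have -> : (3 * side k)%:E = (P%:R * (3 * side (k + k0)))%:E :> \bar R.
  congr EFin; rewrite mulrCA; congr (3 * _)%R.
  rewrite /P; elim: k0 {k0P P P0} => [|n IH]; first by rewrite addn0 big_geq// mul1r.
  rewrite addnS big_nat_recr ?leq_addr//= natrM -mulrA [X in (_ * X)%R]mulrC.
  by rewrite sideS.
apply: (@hausdorff1_delta_fin_cover _ _ _ _
  (fun j => fractal `&` [set z | cell (k + k0) (z ord0 ord0) = (i * P + j)%N])).
- have := side_gt0 (R := R) (k + k0); have := k0P (k + k0)%N (leq_addl _ _).
  by move=> *; apply/andP; split; lra.
- move=> z [Ez /= zi]; exists (cell (k + k0) (z ord0 ord0) %% P)%N => /=.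
    by rewrite ltn_mod.
  split => //=; rewrite {1}(divn_eq (cell (k + k0) (z ord0 ord0)) P).
  by rewrite -zi (cell_anc k k0 (fractal_ge0 Ez)).
- by move=> j z w [Ez /= zi] [Ew /= wi]; apply: fractal_cell_edist; rewrite ?zi ?wi.
Qed.

Lemma H1_fractal_cells k (s : seq nat) :
  H1 R (fractal `&` [set z | cell k (z ord0 ord0) \in s]) <=
  ((size s)%:R * (3 * side k))%:E.
Proof.
elim: s => [|i s IH].
  by rewrite (_ : _ `&` _ = set0) ?outer_measure0 ?mul0r// -subset0 => z [].
rewrite /= -natr1 mulrDl mul1r EFinD.
apply: le_trans (leeD IH (H1_fractal_cell k i)).
apply: le_trans (outer_measureU2 _ _ _); apply: le_outer_measure => z [Ez /=].
by rewrite inE => /orP[/eqP|]; [right|left].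
Qed.

Lemma H1_fractal_lt_pinfty : H1 R fractal < +oo.
Proof.
apply: le_lt_trans (ltry (1%:R * (3 * side 0))).
apply: le_trans (H1_fractal_cells 0 [:: 0%N]); apply: le_outer_measure => z Ez.
split=> //=; rewrite inE; have := cell_lt 0 Ez.1.
by rewrite /ncell big_ord0 ltnS leqn0.
Qed.

End fractal.

(** * Positivity of the measure *)

Section fractal_measure.
Context {R : realType}.
Implicit Types (x y : R) (z w : plane R).

Definition point x y : plane R := \row_(j < 2) (if j == ord0 then x else y).

Lemma point_fst x y : point x y ord0 ord0 = x. Proof. by rewrite mxE. Qed.
Lemma point_snd x y : point x y ord0 ord_max = y. Proof. by rewrite mxE. Qed.

Lemma fractal_over x : 0 <= x < 1 -> exists2 z, fractal z & z ord0 ord0 = x.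
Proof.
move=> x01; pose S := range (fun k => height k x).
have hub j : ubound S (height j x + 2 * side j).
  move=> _ [k _ <-].
  have [jk|/ltnW kj] := leqP j k.
    by have /andP[_] := height_itv x jk; have := side_gt0 (R := R) k; lra.
  by have /andP[] := height_itv x kj; have := side_gt0 (R := R) j; lra.
exists (point x (sup S)); last exact: point_fst.
split; rewrite point_fst// => k; rewrite point_snd; apply/andP; split.
  by apply: ub_le_sup; [exists (height 0 x + 2 * side 0)|exists k].
by apply: ge_sup; [exists (height 0 x); exists 0%N|exact: hub].
Qed.

Local Open Scope ereal_scope.

(** The projection to the first axis covers [0, 1[, and it maps a set of
    diameter [d] into the interval of length [2 * d] centred at the projection
    of any of its points. *)
Lemma H1_fractal_gt0 : 0 < H1 R fractal.
Proof.
apply: lt_le_trans (hausdorff1_delta_le fractal ltr01).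
apply: (@lt_le_trans _ _ (2^-1)%:E); first by rewrite lte_fin.
apply: le_ereal_inf_tmp => _ [U [dU EU] <-].
have fd k : diam (U k) \is a fin_num.
  by rewrite ge0_fin_numE ?diam_ge0// (le_lt_trans (dU k)) ?ltry.
pose d k := fine (diam (U k)).
have d0 k : (0 <= d k)%R by rewrite fine_ge0 ?diam_ge0.
pose c k := (xget 0%R (U k)) ord0 ord0.
pose J k := `[(c k - d k)%R, (c k + d k)%R]%classic.
have covJ : `[0%R, 1%R[%classic `<=` \bigcup_k J k.
  move=> x; rewrite /= in_itv/= => /fractal_over[z Ez zx].
  have [k _ Uz] := EU _ Ez; exists k => //.
  have Uc : U k (xget 0%R (U k)) by apply: xgetI Uz.
  have := le_diam Uz Uc; rewrite -(fineK (fd k)) lee_fin -/(d k) => zd.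
  have := le_trans (normr_le_edist _ _ ord0) zd; rewrite zx -/(c k) ler_norml.
  by rewrite /J /= in_itv/= => /andP[? ?]; apply/andP; split; lra.
have : lebesgue_measure (`[0%R, 1%R[%classic : set R) <= \sum_(k <oo) lebesgue_measure (J k).
  apply: measure_sigma_subadditive => //.
  by move=> k; exact: measurable_itv.
rewrite lebesgue_measure_itv/= lte_fin ltr01 oppr0 adde0 => le1.
have -> : \sum_(k <oo) diam (U k) = \sum_(k <oo) (2^-1)%:E * lebesgue_measure (J k).
  apply: eq_eseriesr => k _; rewrite /J lebesgue_measure_itv/= lte_fin.
  rewrite -(fineK (fd k)) -/(d k); case: ltP => cd.
    by rewrite -EFinD -EFinM; congr EFin; lra.
  by rewrite mule0; congr EFin; have := d0 k; lra.
rewrite nneseriesZl//.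
by rewrite -[leLHS]mule1 lee_pmul2l ?lte_fin ?invr_gt0.
Qed.

End fractal_measure.

(** * Measurability *)

Section fractal_measurable.
Context {R : realType}.
Local Notation cplane := (caratheodory_type (H1 R)).

Lemma measurable_coord_lt i (a : R) :
  measurable ([set z | (z : plane R) ord0 i < a] : set cplane).
Proof. exact: halfplane_caratheodory. Qed.

Lemma measurable_coord_ge i (a : R) :
  measurable ([set z | a <= (z : plane R) ord0 i] : set cplane).
Proof.
rewrite [X in measurable X](_ : _ = ~` [set z : cplane | (z : plane R) ord0 i < a]).
  by apply: measurableC; exact: measurable_coord_lt.
by apply/seteqP; split => z /=; rewrite leNgt; move/negP.
Qed.

Lemma measurable_coord_le i (a : R) :
  measurable ([set z | (z : plane R) ord0 i <= a] : set cplane).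
Proof.
rewrite [X in measurable X](_ : _ =
    \bigcap_n [set z : cplane | (z : plane R) ord0 i < a + n.+1%:R^-1]).
  by apply: bigcapT_measurable => n; exact: measurable_coord_lt.
apply/seteqP; split => z /= za.
  by move=> n _ /=; rewrite (le_lt_trans za)// ltrDl invr_gt0.
apply/ler_addgt0Pr => e e0.
have /= := za (Num.truncn e^-1) I => /ltW/le_trans; apply.
rewrite lerD2l -[leRHS]invrK lef_pV2 ?posrE ?invr_gt0 ?ltr0n//.
exact/ltW/truncnS_gt.
Qed.

Definition strip k i : set (plane R) :=
  [set z | 0 <= z ord0 ord0 /\ cell k (z ord0 ord0) = i].

Lemma stripE k i : strip k i =
  [set z | i%:R * side k <= z ord0 ord0] `&` [set z | z ord0 ord0 < i.+1%:R * side k].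
Proof.
apply/seteqP; split => z /= [].
  by move=> /cell_itv /[swap] <- /(_ k)/andP.
move=> h1 h2; split; last by apply: cell_def; rewrite h1.
by apply: le_trans h1; rewrite mulr_ge0// ltW// side_gt0.
Qed.

Lemma measurable_strip k i : measurable (strip k i : set cplane).
Proof.
rewrite stripE; apply: measurableI;
  [exact: measurable_coord_ge|exact: measurable_coord_lt].
Qed.

Lemma measurable_fractal : measurable (fractal : set cplane).
Proof.
pose hgt k i : R := height k (i%:R * side k).
have hgtE k i z : strip k i z -> height k (z ord0 ord0) = hgt k i.
  by move=> [z0 <-]; rewrite /hgt height_cell.
rewrite [X in measurable X](_ : _ =
    [set z : plane R | 0 <= z ord0 ord0] `&` [set z : plane R | z ord0 ord0 < 1] `&`
    \bigcap_k \bigcup_i (strip k i `&`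
      ([set z : plane R | hgt k i <= z ord0 ord_max] `&`
       [set z : plane R | z ord0 ord_max <= hgt k i + 2 * side k]))).
  apply: measurableI.
    by apply: measurableI; [exact: measurable_coord_ge|exact: measurable_coord_lt].
  apply: bigcapT_measurable => k; apply: bigcupT_measurable => i.
  apply: measurableI; first exact: measurable_strip.
  by apply: measurableI; [exact: measurable_coord_ge|exact: measurable_coord_le].
apply/seteqP; split => z.
  move=> Ez; have z0 := fractal_ge0 Ez; split; first by case: Ez => /andP[].
  move=> k _; exists (cell k (z ord0 ord0)) => //.
  by split => //; rewrite -(hgtE _ _ z)//; have /andP[] := Ez.2 k.
move=> [[z0 z1] Ez]; split; first by apply/andP.
move=> k; have [i _ [ki [/= h1 h2]]] := Ez k I.
by rewrite (hgtE _ _ _ ki) h1 h2.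
Qed.

End fractal_measurable.

(** * Counting the cells met by a subset *)

Section hits.
Context {R : realType}.
Implicit Types (A : set (plane R)).

Definition hit A k i : bool :=
  `[< exists2 z, A z & cell k (z ord0 ord0) = i >].

Definition split_hit A k i : bool :=
  hit A k.+1 (i * nchild k + mid k) &&
  [exists j : 'I_(nchild k), (j != mid k :> nat) && hit A k.+1 (i * nchild k + j)].

Definition nhit A k : nat := \sum_(0 <= i < ncell k) hit A k i.
Definition nsplit A k : nat := \sum_(0 <= i < ncell k) split_hit A k i.

Lemma hit_parent A k i j : A `<=` fractal -> (j < nchild k)%N ->
  hit A k.+1 (i * nchild k + j) -> hit A k i.
Proof.
move=> AE jN /asboolP[z Az zi]; apply/asboolP; exists z => //.
rewrite (cell_parent _ (fractal_ge0 (AE z Az))) zi.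
by rewrite divnMDl ?nchild_gt0// divn_small// addn0.
Qed.

(** A set that does not split the cell misses its middle child, or all the
    others: in both cases it meets at most [(nchild k).-1] children. *)
Lemma sum_hit_children A k i : A `<=` fractal ->
  (\sum_(i * nchild k <= j < i.+1 * nchild k) hit A k.+1 j <=
   (nchild k).-1 * hit A k i + split_hit A k i)%N.
Proof.
move=> AE; rewrite -{1}[(i * nchild k)%N]add0n big_addn mulSn addnK big_mkord.
set N := nchild k; have N1 : (1 < N)%N by rewrite /N /nchild; lia.
have mN : (mid k < N)%N by rewrite /N /nchild /mid; lia.
pose m := Ordinal mN.
have [hi|nhi] := boolP (hit A k i); last first.
  rewrite big1// => j _; apply/eqP; rewrite eqb0; apply: contra nhi.
  by rewrite addnC; exact: hit_parent.
have le1 (P : pred 'I_N) : (\sum_(j < N | P j) hit A k.+1 (j + i * N) <= \sum_(j < N | P j) 1)%N.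
  by apply: leq_sum => j _; exact: leq_b1.
have [bi|] := boolP (split_hit A k i).
  by rewrite muln1 addn1 prednK ?(ltnW N1)// (leq_trans (le1 _))// sum1_card card_ord.
rewrite /split_hit negb_and => /orP[nm|/existsPn nj]; rewrite muln1 addn0.
  rewrite addnC in nm; rewrite (bigD1 m)//= (negbTE nm) add0n (leq_trans (le1 _))//.
  by rewrite sum1_card cardC1 card_ord.
rewrite (bigD1 m)//= big1 ?addn0.
  by rewrite (leq_trans (leq_b1 _))//; lia.
move=> j jm; apply/eqP; rewrite eqb0.
by have := nj j; rewrite negb_and negbK addnC => /orP[/eqP jE|//];
  case/eqP: jm; exact: val_inj.
Qed.

Lemma nhitS A k : A `<=` fractal ->
  (nhit A k.+1 <= (nchild k).-1 * nhit A k + nsplit A k)%N.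
Proof.
move=> AE; rewrite /nhit ncellS big_nat_mul /nsplit big_distrr/= -big_split/=.
by apply: leq_sum => i _; exact: sum_hit_children.
Qed.

Lemma H1_le_nhit A k : A `<=` fractal ->
  (H1 R A <= (3 * ((nhit A k)%:R * side k))%:E)%E.
Proof.
move=> AE; pose s := [seq i <- index_iota 0 (ncell k) | hit A k i].
have -> : nhit A k = size s.
  by rewrite -sum1_size big_filter/= big_mkcond.
rewrite mulrCA; apply: le_trans (H1_fractal_cells k s).
apply: le_outer_measure => z Az; have Ez := AE z Az; split => //=.
rewrite mem_filter mem_index_iota /= (cell_lt k Ez.1) andbT.
by apply/asboolP; exists z.
Qed.

Lemma inv_nchild_dvg (C : R) :
  exists n, C < \sum_(0 <= k < n) ((nchild k)%:R^-1 : R).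
Proof.
apply: contrapT => /forallNP bnd; apply: (@dvg_harmonic R).
apply: nondecreasing_is_cvgn.
  apply/nondecreasing_seqP => n; rewrite -subr_ge0 seriesSB; exact: harmonic_ge0.
exists (64 * C) => _ [n _ <-].
have := bnd n => /negP; rewrite -leNgt => le.
apply: (le_trans _ (ler_wpM2l _ le)) => //.
rewrite /series/= mulr_sumr; apply: ler_sum => k _.
rewrite -[leLHS]mul1r -ler_pdivrMl// mul1r -invfM lef_pV2 ?posrE ?mulr_gt0 ?ltr0n ?nchild_gt0//.
by rewrite -natrM ler_nat /nchild; lia.
Qed.

(** Let [u k] be the total length of the cells of generation [k] that [A] meets.
    Up to a summable error it decreases by [u k / nchild k] at each step, so it
    cannot stay away from 0. *)
Lemma H1_eq0_of_nsplit A (C : R) : A `<=` fractal ->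
  (forall n, \sum_(0 <= k < n) (nsplit A k)%:R * side k <= C) -> H1 R A = 0%E.
Proof.
move=> AE bC; pose u k : R := (nhit A k)%:R * side k.
have u_ge0 k : 0 <= u k by rewrite mulr_ge0// ltW// side_gt0.
have uS k : u k.+1 <= u k - u k / (nchild k)%:R + (nsplit A k)%:R * side k.
  have := nhitS k AE; rewrite -(ler_nat R) /u.
  rewrite natrD natrM -subn1 natrB ?nchild_gt0// => h.
  have N0 : 0 < (nchild k)%:R :> R by rewrite ltr0n nchild_gt0.
  have N1 : 1 <= (nchild k)%:R :> R by rewrite ler1n nchild_gt0.
  have s0 := side_gt0 (R := R) k.+1.
  rewrite -(sideS k); apply: (le_trans (ler_wpM2r (ltW s0) h)).
  rewrite mulrA mulfK ?gt_eqF//.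
  have : 0 <= (nsplit A k)%:R * side k.+1 * ((nchild k)%:R - 1) :> R.
    by apply: mulr_ge0; [apply: mulr_ge0 => //; exact: ltW|rewrite subr_ge0].
  lra.
suff small (e : R) : 0 < e -> exists k, u k <= e.
  apply/eqP; rewrite eq_le outer_measure_ge0 andbT.
  apply/lee_addgt0Pr => e e0; rewrite add0e.
  have e30 : 0 < e / 3 by rewrite divr_gt0.
  have [k uk] := small _ e30.
  by apply: le_trans (H1_le_nhit k AE) _; rewrite lee_fin -/(u k); lra.
move=> e0; apply: contrapT => /forallNP big.
have ge_e k : e < u k by rewrite ltNge; apply/negP/big.
have [n nC] := inv_nchild_dvg ((u 0%N + C) / e).
have : u n <= u 0%N - e * (\sum_(0 <= k < n) (nchild k)%:R^-1) +
    \sum_(0 <= k < n) (nsplit A k)%:R * side k.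
  elim: n {nC} => [|n IH]; first by rewrite !big_geq// mulr0 subr0 addr0.
  rewrite !big_nat_recr//=.
  have : e / (nchild n)%:R <= u n / (nchild n)%:R.
    by rewrite ler_pM2r ?invr_gt0 ?ltr0n ?nchild_gt0// ltW.
  have := uS n; lra.
have := bC n; have := u_ge0 n; move: nC; rewrite ltr_pdivrMr// mulrC.
lra.
Qed.

End hits.

(** * Crossing times of Lipschitz functions *)

Section crossing.
Context {R : realType}.

(** The interval runs from the last time at which [u <= r1] to the first later
    time at which [r2 <= u]. *)
Lemma crossing_lt (u : R -> R) (M r1 r2 s t : R) : 0 < M ->
  (forall x y, `|u x - u y| <= M * `|x - y|) ->
  s <= t -> u s <= r1 -> r1 < r2 -> r2 <= u t ->
  exists a b, [/\ s <= a, b <= t, (r2 - r1) / M <= b - a &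
    forall x, a < x < b -> r1 < u x < r2].
Proof.
move=> M0 uM st us r12 ut.
pose S1 := [set x | s <= x <= t /\ u x <= r1].
have S1s : S1 s by split=> //; rewrite lexx.
have ubS1 : has_ubound S1 by exists t => x [/andP[]].
pose a := sup S1.
have aP x : S1 x -> x <= a by move=> S1x; exact: ub_le_sup.
have at_ : a <= t by apply: ge_sup; [exists s|move=> x [/andP[]]].
pose S2 := [set x | a <= x <= t /\ r2 <= u x].
have S2t : S2 t by split=> //; rewrite at_ lexx.
have lbS2 : has_lbound S2 by exists a => x [/andP[]].
exists a, (inf S2); split; [exact: aP|exact: ge_inf| |].
  rewrite lerBrDr; apply: lb_le_inf; first by exists t.
  move=> y [/andP[ay yt] uy]; rewrite addrC -lerBrDr.
  apply: ge_sup; first by exists s.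
  move=> x [sxt ux]; rewrite lerBrDr -lerBrDl ler_pdivrMr// mulrC.
  have xy : x <= y by apply: le_trans ay; exact: aP.
  have := uM y x; rewrite [`|y - x|]ger0_norm ?subr_ge0//.
  by apply: le_trans; apply: le_trans (ler_norm _); lra.
move=> x /andP[ax xb].
have xt : x <= t by apply: le_trans (ltW xb) _; exact: ge_inf.
apply/andP; split.
  rewrite ltNge; apply/negP => ux.
  suff /aP : S1 x by rewrite leNgt ax.
  by split=> //; rewrite xt (le_trans (aP _ S1s) (ltW ax)).
rewrite ltNge; apply/negP => ux.
suff : inf S2 <= x by rewrite leNgt xb.
by apply: ge_inf => //; split => //; rewrite xt ltW.
Qed.

Lemma crossing (u : R -> R) (M r1 r2 s t T : R) : 0 < M ->
  (forall x y, `|u x - u y| <= M * `|x - y|) ->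
  `|s| <= T -> `|t| <= T -> u s <= r1 -> r1 < r2 -> r2 <= u t ->
  exists p : R * R, (r2 - r1) / M <= p.2 - p.1 /\
    forall x, p.1 < x < p.2 -> `|x| <= T /\ r1 < u x < r2.
Proof.
rewrite !ler_norml => M0 uM /andP[s1 s2] /andP[t1 t2] us r12 ut.
have [st|/ltW ts] := leP s t.
  have [a [b [sa bt ab h]]] := crossing_lt M0 uM st us r12 ut.
  exists (a, b); split => //= x axb; rewrite (h _ axb).
  by move: axb => /andP[? ?]; rewrite ler_norml; split => //; apply/andP; split; lra.
have [|||||a [b [sa bt ab h]]] :=
    @crossing_lt (fun x => u (- x)) M r1 r2 (- s) (- t) M0.
- by move=> x y; rewrite (le_trans (uM _ _))// -opprD normrN.
- by rewrite lerN2.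
- by rewrite opprK.
- by [].
- by rewrite opprK.
exists (- b, - a); split => /=; first by rewrite opprK [- a + b]addrC.
move=> x /andP[bx xa].
have /h : a < - x < b by apply/andP; split; lra.
by rewrite opprK => ->; rewrite ler_norml; split => //; apply/andP; split; lra.
Qed.

End crossing.

(** * Disjoint annuli around the lifted pieces *)

Section annuli.
Context {R : realType}.
Implicit Types (z w : plane R).

(** The sup-norm distance to the left end of the lifted middle piece of the cell
    [i] of generation [k]; the abscissa is that of the centre of the cell. *)
Definition center_dist k i z : R :=
  Num.max `|z ord0 ord0 - (i%:R + 2^-1) * side k|
          `|z ord0 ord_max - (height k (i%:R * side k) + side k)|.

Definition annulus k i : set (plane R) :=
  [set z | side k / 8 < center_dist k i z < side k / 4].

Lemma center_dist_lip k i z w :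
  `|center_dist k i z - center_dist k i w| <= edist z w.
Proof.
rewrite /center_dist.
set a := (_ + _) * _; set b := height _ _ + _.
have h0 := normr_le_edist z w ord0; have h1 := normr_le_edist z w ord_max.
have lip (x y c : R) : `| `|x - c| - `|y - c| | <= `|x - y|.
  have -> : x - y = x - c - (y - c) by ring.
  exact: ler_dist_dist.
have k0 := le_trans (lip _ _ a) h0; have k1 := le_trans (lip _ _ b) h1.
move: k0 k1; rewrite !ler_norml => /andP[? ?] /andP[? ?].
clear h0 h1 lip.
by case: (leP `|z ord0 ord0 - a| `|z ord0 ord_max - b|) => ?;
  case: (leP `|w ord0 ord0 - a| `|w ord0 ord_max - b|) => ?; apply/andP; split; lra.
Qed.

(** As [side k.+1 <= side k / 64], the graph over the middle child lies within
    the inner radius of the annulus and the rest of the graph over the cell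
    lies beyond its outer radius. *)
Lemma center_dist_lifted k z : fractal z -> lifted k (z ord0 ord0) ->
  center_dist k (cell k (z ord0 ord0)) z <= side k / 8.
Proof.
move=> Ez lz; have z0 := fractal_ge0 Ez.
have s0 := side_gt0 (R := R) k.+1; have s1 := side_small (R := R) k.
rewrite /center_dist ge_max height_cell//; apply/andP; split.
  by have /andP[? ?] := lifted_near_center z0 lz; rewrite ger0_norm//; lra.
have /andP[] := Ez.2 k.+1; rewrite heightS lz mul1r => ? ?.
by rewrite ger0_norm; lra.
Qed.

Lemma center_dist_not_lifted k z : fractal z -> ~~ lifted k (z ord0 ord0) ->
  side k / 4 <= center_dist k (cell k (z ord0 ord0)) z.
Proof.
move=> Ez /negbTE lz; have z0 := fractal_ge0 Ez.
have s0 := side_gt0 (R := R) k.+1; have s1 := side_small (R := R) k.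
rewrite /center_dist le_max height_cell//; apply/orP; right.
have /andP[] := Ez.2 k.+1; rewrite heightS lz mul0r addr0 => ? ?.
by rewrite ltr0_norm; lra.
Qed.

Lemma annulus_cell k i z : annulus k i z ->
  0 <= z ord0 ord0 /\ cell k (z ord0 ord0) = i.
Proof.
have s0 := side_gt0 (R := R) k.
move=> /andP[_]; rewrite gt_max => /andP[+ _]; rewrite ltr_norml => /andP[h1 h2].
have i0 : 0 <= i%:R * side k :> R by rewrite mulr_ge0// ltW.
split; first by lra.
by apply: cell_def; rewrite -natr1; apply/andP; split; lra.
Qed.

Lemma annulus_height k z : annulus k (cell k (z ord0 ord0)) z -> 0 <= z ord0 ord0 ->
  `|z ord0 ord_max - (height k (z ord0 ord0) + side k)| < side k / 4.
Proof.
by move=> /andP[_]; rewrite gt_max => /andP[_ +] z0; rewrite height_cell.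
Qed.

(** The annulus of a descendant is close to the graph over that descendant: over
    the middle child this is inside the smaller radius of the annulus of
    generation [j], over another child it is outside the larger one. *)
Lemma annulus_level_disjoint j k i i' z : (j < k)%N ->
  annulus j i z -> annulus k i' z -> False.
Proof.
move=> jk aj ak; have [z0 ij] := annulus_cell aj; have [_ ik] := annulus_cell ak.
subst i i'; have := annulus_height ak z0.
have /andP[h1 h2] := height_itv (z ord0 ord0) jk.
have s0 := side_gt0 (R := R) k; have s1 := side_small (R := R) j.
have s2 : side k <= side j.+1 :> R := side_anti jk.
rewrite ltr_norml => /andP[h3 h4]; rewrite heightS in h1 h2.
move: aj => /andP[+ +]; rewrite lt_max gt_max height_cell// => /orP a1 /andP[a2 a3].
case: (boolP (lifted j (z ord0 ord0))) h1 h2 => [lz|_] /= h1 h2.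
  rewrite mul1r in h1 h2.
  have /andP[? ?] := lifted_near_center z0 lz.
  case: a1; first by rewrite ger0_norm//; lra.
  by case: ger0P; lra.
by move: a3; rewrite ltr_norml => /andP[]; lra.
Qed.

Lemma annulus_disjoint j k i i' z : annulus j i z -> annulus k i' z -> j = k /\ i = i'.
Proof.
move=> aj ak; have [jk|kj|jk] := ltngtP j k.
- by case: (annulus_level_disjoint jk aj ak).
- by case: (annulus_level_disjoint kj ak aj).
- by subst k; have [_ <-] := annulus_cell aj; have [_ <-] := annulus_cell ak.
Qed.

End annuli.

(** * Lipschitz curves meet the set in measure zero *)

Section curves.
Context {R : realType}.
Variables (f : R -> plane R) (M T : R).
Hypotheses (M0 : 0 < M) (T0 : 0 < T).
Hypothesis fM : forall s t, edist (f s) (f t) <= M * `|s - t|.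

Let A := fractal `&` f @` [set t | `|t| <= T].

Lemma split_crossing k i : split_hit A k i ->
  exists p : R * R, side k / 8 / M <= p.2 - p.1 /\
    forall x, p.1 < x < p.2 -> `|x| <= T /\ annulus k i (f x).
Proof.
move=> /andP[/asboolP[z [Es [s /= sT fs]] si] /existsP[j /andP[jm]]].
move=> /asboolP[w [Et [t /= tT ft]] ti]; subst z w.
have N0 := nchild_gt0 k.
have mN : (mid k < nchild k)%N by rewrite /nchild /mid; lia.
have cs : cell k (f s ord0 ord0) = i.
  by rewrite (cell_parent _ (fractal_ge0 Es)) si divnMDl// divn_small// addn0.
have ct : cell k (f t ord0 ord0) = i.
  by rewrite (cell_parent _ (fractal_ge0 Et)) ti divnMDl// divn_small// addn0.
have ls : lifted k (f s ord0 ord0) by rewrite /lifted si modnMDl modn_small.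
have lt : ~~ lifted k (f t ord0 ord0).
  by rewrite /lifted ti modnMDl modn_small// jm.
have := center_dist_lifted Es ls; have := center_dist_not_lifted Et lt.
rewrite cs ct => ht hs.
have [||p [ps ph]] := crossing (u := fun x => center_dist k i (f x)) M0 _ sT tT hs _ ht.
- by move=> x y; exact: le_trans (center_dist_lip _ _ _ _) (fM _ _).
- by have := side_gt0 (R := R) k; lra.
exists p; split => //; rewrite (le_trans _ ps)// ler_pM2r ?invr_gt0//; lra.
Qed.

(** The time intervals given by [split_crossing] are disjoint and lie in
    [[- T, T]]. *)
Lemma nsplit_bound n :
  \sum_(0 <= k < n) (nsplit A k)%:R * side k <= 16 * M * T.
Proof.
have [I IP] : {I : nat * nat -> R * R & forall ki, split_hit A ki.1 ki.2 ->
    side ki.1 / 8 / M <= (I ki).2 - (I ki).1 /\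
    forall x, (I ki).1 < x < (I ki).2 -> `|x| <= T /\ annulus ki.1 ki.2 (f x)}.
  apply: (@choice _ _ (fun ki p => split_hit A ki.1 ki.2 ->
    side ki.1 / 8 / M <= p.2 - p.1 /\
    forall x, p.1 < x < p.2 -> `|x| <= T /\ annulus ki.1 ki.2 (f x))) => -[k i]/=.
  have [/split_crossing[p ?]|_] := boolP (split_hit A k i); first by exists p.
  by exists (0, 0).
pose W k i : set R := if split_hit A k i then `](I (k, i)).1, (I (k, i)).2[%classic else set0.
have WP k i x : W k i x -> `|x| <= T /\ annulus k i (f x).
  rewrite /W; case: ifP => // bi; rewrite /= in_itv/=.
  by have [_] := IP (k, i) bi; exact.
have mW k i : measurable (W k i).
  by rewrite /W; case: ifP => // _; exact: measurable_itv.
have lW k i : (((split_hit A k i)%:R * (side k / 8 / M))%:E <= lebesgue_measure (W k i))%E.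
  rewrite /W; case: ifP => [bi|_]; last by rewrite mul0r measure0.
  have [/= h _] := IP (k, i) bi.
  have s0 : 0 < side k / 8 / M by rewrite !divr_gt0// side_gt0.
  rewrite lebesgue_measure_itv/= lte_fin -subr_gt0 (lt_le_trans s0 h) mul1r.
  by rewrite -EFinD lee_fin.
pose V k := \big[setU/set0]_(i < ncell k) W k i.
have VP k x : V k x -> exists i, W k i x.
  by rewrite /V -bigcup_mkord => -[i _ Wx]; exists i.
have mV k : measurable (V k) by apply: bigsetU_measurable.
have lV k : (((nsplit A k)%:R * (side k / 8 / M))%:E <= lebesgue_measure (V k))%E.
  have tW : trivIset setT (W k).
    apply/trivIsetP => i j _ _ ij; rewrite -subset0 => x [/WP[_ ai] /WP[_ aj]].
    by have [_ /eqP] := annulus_disjoint ai aj; rewrite (negbTE ij).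
  rewrite /V measure_bigsetU; [|exact: mW|exact: tW].
  rewrite /nsplit natr_sum big_distrl/= -sumEFin big_mkord.
  by apply: lee_sum => i _; exact: lW.
have tV : trivIset setT V.
  apply/trivIsetP => i j _ _ ij; rewrite -subset0 => x [].
  move=> /VP[? /WP[_ ai]] /VP[? /WP[_ aj]].
  by have [/eqP] := annulus_disjoint ai aj; rewrite (negbTE ij).
have : (\sum_(k < n) lebesgue_measure (V k) <= (2 * T)%:E)%E.
  rewrite -measure_bigsetU; [|exact: mV|exact: tV].
  apply: (@le_trans _ _ (lebesgue_measure (`[- T, T]%classic : set R))).
    apply: le_measure; rewrite ?inE.
    - by apply: bigsetU_measurable => k _; exact: mV.
    - exact: measurable_itv.
    - move=> x; rewrite -bigcup_mkord => -[k _ /VP[i /WP[xT _]]].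
      by rewrite /= in_itv/= -ler_norml.
  rewrite lebesgue_measure_itv/= lte_fin -subr_gt0 opprK addr_gt0//.
  by rewrite lee_fin; lra.
have : (\sum_(k < n) ((nsplit A k)%:R * (side k / 8 / M))%:E <=
    \sum_(k < n) lebesgue_measure (V k))%E by apply: lee_sum => k _; exact: lV.
move=> /le_trans /[apply]; rewrite sumEFin lee_fin big_mkord.
have -> : \sum_(k < n) (nsplit A k)%:R * (side k / 8 / M) =
    (\sum_(k < n) (nsplit A k)%:R * side k) / (8 * M).
  by rewrite mulr_suml; apply: eq_bigr => k _; field; rewrite gt_eqF.
by rewrite ler_pdivrMr ?mulr_gt0//; lra.
Qed.

Lemma H1_fractal_arc : H1 R A = 0%E.
Proof.
apply: (@H1_eq0_of_nsplit _ _ (16 * M * T)); first exact: subIsetl.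
exact: nsplit_bound.
Qed.

End curves.

Lemma H1_fractal_curve {R : realType} (f : R -> plane R) : lipschitz_curve f ->
  H1 R (fractal `&` range f) = 0%E.
Proof.
move=> [K fK]; pose M := Num.max K 1.
have M0 : 0 < M by rewrite lt_max ltr01 orbT.
have fM s t : edist (f s) (f t) <= M * `|s - t|.
  by apply: le_trans (fK s t) _; rewrite ler_wpM2r// le_max lexx.
apply/eqP; rewrite eq_le outer_measure_ge0 andbT.
apply: (@le_trans _ _ (H1 R (\bigcup_n (fractal `&` f @` [set t | `|t| <= n.+1%:R])))).
  apply: le_outer_measure => z [Ez [t _ tz]].
  exists (Num.truncn `|t|) => //; split => //; exists t => //=.
  exact/ltW/truncnS_gt.
apply: le_trans (outer_measure_sigma_subadditive _ _) _.
by rewrite eseries0// => n _ _; rewrite (H1_fractal_arc M0 _ fM).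
Qed.

Lemma fractal_purely_unrectifiable {R : realType} :
  purely_unrectifiable (fractal : set (plane R)).
Proof.
move=> F FE [_ [f [flip f0]] _].
apply/eqP; rewrite eq_le outer_measure_ge0 andbT.
apply: (@le_trans _ _ (H1 R ((~` (\bigcup_i range (f i)) `&` F) `|`
    \bigcup_i (fractal `&` range (f i))))).
  apply: le_outer_measure => z Fz.
  have [[i _ fz]|nz] := pselect ((\bigcup_i range (f i)) z); last by left.
  by right; exists i => //; split => //; exact: FE.
apply: le_trans (outer_measureU2 _ _ _) _; rewrite [X in (X + _)%E]f0 add0e.
apply: le_trans (outer_measure_sigma_subadditive _ _) _.
by rewrite eseries0// => i _ _; exact: H1_fractal_curve.
Qed.

(** * Upper bounds for integrals of arbitrary nonnegative functions *)

Section lower_integral.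
Local Open Scope ereal_scope.
Context d (T : measurableType d) (R : realType).
Variable mu : {measure set T -> \bar R}.

(** The integral of a nonnegative function is a supremum over the measurable
    simple functions below it, hence it is monotone on arbitrary functions. *)
Lemma ge0_le_integral_nomeas (D : set T) (f g : T -> \bar R) :
  (forall x, D x -> 0 <= f x) -> (forall x, 0 <= g x) ->
  (forall x, D x -> f x <= g x) ->
  \int[mu]_(x in D) f x <= \int[mu]_x g x.
Proof.
move=> f0 g0 fg; rewrite ge0_integralE// ge0_integralTE//.
apply: ge_ereal_sup => _ [h /= hf <-]; apply: ereal_sup_ubound.
exists h => // x; apply: le_trans (hf x) _; rewrite patchE; case: ifPn => // xD.
by apply: fg; rewrite inE in xD.
Qed.

Lemma le_integral_two_steps (D A B N : set T) (f : T -> \bar R) (a b : R) :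
  measurable A -> measurable B -> measurable N -> mu N = 0 ->
  (0 <= a)%R -> (0 <= b)%R -> (forall x, D x -> 0 <= f x) ->
  (forall x, D x -> ~ N x -> f x <= (a * \1_A x + b * \1_B x)%:E) ->
  \int[mu]_(x in D) f x <= a%:E * mu A + b%:E * mu B.
Proof.
move=> mA mB mN N0 a0 b0 f0 fle.
pose g x := (a%:E * (\1_A x)%:E + b%:E * (\1_B x)%:E) + +oo * (\1_N x)%:E.
have ge0 (C : set T) x : 0 <= (\1_C x)%:E :> \bar R by rewrite lee_fin.
have abge0 x : 0 <= a%:E * (\1_A x)%:E + b%:E * (\1_B x)%:E.
  by rewrite adde_ge0// mule_ge0.
pose ind (C : set T) : T -> \bar R := fun x => (\1_C x)%:E.
have mi (C : set T) : measurable C -> measurable_fun setT (ind C).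
  by move=> mC; apply/measurable_EFinP.
pose ab : T -> \bar R := fun x => a%:E * ind A x + b%:E * ind B x.
have mab : measurable_fun setT ab.
  by apply: emeasurable_funD; apply: measurable_funeM; exact: mi.
(* The value [+oo] on the null set [N] adds nothing to the integral of [g] and
   dominates whatever [f] is there. *)
apply: (@le_trans _ _ (\int[mu]_x g x)).
  apply: ge0_le_integral_nomeas => //.
    by move=> x; rewrite /g adde_ge0// mule_ge0.
  move=> x Dx; rewrite /g; have [Nx|nNx] := pselect (N x).
    rewrite [X in +oo * X%:E]indicE (mem_set Nx) mule1 addey ?leey//.
  by rewrite [X in +oo * X%:E]indicE (memNset nNx) mule0 adde0 -!EFinM -EFinD; exact: fle.
have scale c (C : set T) : 0 <= c -> measurable C ->
    measurable_fun setT (fun x => c * ind C x) /\ forall x, setT x -> 0 <= c * ind C x.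
  move=> c0 mC; split; first by apply: measurable_funeM; exact: mi.
  by move=> x _; exact: mule_ge0 c0 (ge0 C x).
have [mf1 f10] := scale a%:E A a0 mA; have [mf2 f20] := scale b%:E B b0 mB.
have [mf3 f30] := scale +oo N (leey 0) mN.
rewrite (@ge0_integralD _ _ _ mu _ measurableT ab _ (fun x _ => abge0 x) mab f30 mf3).
rewrite (@ge0_integralD _ _ _ mu _ measurableT _ _ f10 mf1 f20 mf2).
have intE c (C : set T) : 0 <= c -> measurable C ->
    \int[mu]_x (c * ind C x) = c * mu C.
  move=> c0 mC; rewrite (@ge0_integralZl _ _ _ mu _ measurableT _ (mi C mC))//.
    by rewrite integral_indic// setIT.
  by move=> x _; exact: ge0.
by rewrite !intE// ?lee_fin// ?leey// N0 mule0 adde0.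
Qed.

End lower_integral.

(** * The beta numbers of the set *)

Section beta_estimate.
Context {R : realType}.
Implicit Types (z w : plane R).

Lemma caratheodory_restr (A : set (plane R)) :
  (H1 R).-caratheodory A -> (H1_on fractal).-caratheodory A.
Proof.
move=> cA X; rewrite /= /outer_restr (cA (X `&` fractal)).
by rewrite setIAC [in X in _ = (_ + X)%E]setIAC.
Qed.

Lemma measurable_fractal_cells k (s : seq nat) :
  (H1 R).-caratheodory (fractal `&` [set z | cell k (z ord0 ord0) \in s]).
Proof.
suff : measurable (fractal `&` [set z | cell k (z ord0 ord0) \in s] :
  set (caratheodory_type (H1 R))) by [].
elim: s => [|i s IH].
  rewrite [X in measurable X](_ : _ = set0); first exact: measurable0.
  by rewrite -subset0 => z [].
rewrite [X in measurable X](_ : _ = (fractal `&` strip k i) `|`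
    (fractal `&` [set z | cell k (z ord0 ord0) \in s])).
  apply: measurableU => //; apply: measurableI; first exact: measurable_fractal.
  exact: measurable_strip.
apply/seteqP; split => z /=.
  move=> [Ez]; rewrite inE => /orP[/eqP zi|zs]; [left|right] => //.
  by split => //; split => //; exact: fractal_ge0.
by rewrite inE => -[[Ez [_ ->]]|[Ez ->]]; rewrite ?eqxx ?orbT.
Qed.

(** At the first generation [j] at which only one of two points is lifted, their
    heights get apart by [side j], and later lifts cannot make up for it. *)
Lemma height_near k z w : fractal z -> fractal w ->
  (forall j, (j < k)%N -> edist z w < side j / 4) ->
  height k (z ord0 ord0) = height k (w ord0 ord0).
Proof.
move=> Ez Ew; elim: k => [_|k IH zw]; first by rewrite /height !big_ord0.
have {}IH := IH (fun j jk => zw j (ltnW jk)).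
have := le_lt_trans (normr_le_edist z w ord_max) (zw k (ltnSn k)).
have /andP[z1 z2] := Ez.2 k.+1; have /andP[w1 w2] := Ew.2 k.+1.
rewrite ltr_norml => /andP[h1 h2]; rewrite !heightS in z1 z2 w1 w2 *; rewrite IH.
have s0 := side_gt0 (R := R) k.+1; have s1 := side_small (R := R) k.
by case: (lifted k (z ord0 ord0)) (lifted k (w ord0 ord0)) z1 z2 w1 w2 => -[] //=;
  rewrite ?mul1r ?mul0r; lra.
Qed.

Definition hline (h : R) : set (plane R) :=
  [set point 0 h + t *: point 1 0 | t in [set: R]].

Lemma is_line_hline h : is_line (hline h).
Proof.
exists (point 0 h), (point 1 0); split => //.
by apply/eqP => /matrixP/(_ ord0 ord0); rewrite !mxE/= => /eqP; rewrite oner_eq0.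
Qed.

Lemma dist_hline z h : dist_set z (hline h) <= `|z ord0 ord_max - h|.
Proof.
have e : (point 0 h + z ord0 ord0 *: point 1 0) = point (z ord0 ord0) h :> plane R.
  by apply/rowP => j; rewrite !mxE; case: ifP; rewrite ?mulr1 ?mulr0 ?add0r ?addr0.
apply: (@le_trans _ _ (edist z (point (z ord0 ord0) h))).
  apply: ge_inf; first by exists 0 => _ [w _ <-]; exact: edist_ge0.
  by exists (point (z ord0 ord0) h) => //; exists (z ord0 ord0).
by apply: (le_trans (edist_le _ _)); rewrite point_fst point_snd subrr normr0 add0r.
Qed.

Lemma dist_hline_ge0 z h : 0 <= dist_set z (hline h).
Proof.
apply: lb_le_inf; last by move=> _ [w _ <-]; exact: edist_ge0.
by exists (edist z (point 0 h + 0 *: point 1 0)); eexists => //; exists 0.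
Qed.

(** An interval of length [2 * r] meets cells of total length at most
    [2 * r + 3 * side k], and [side k <= 4 * r]. *)
Lemma near_cells k (x r : R) : 0 <= x -> side k / 4 <= r ->
  exists s : seq nat, (size s)%:R * side k <= 14 * r /\
    forall y, 0 <= y -> `|x - y| < r -> cell k y \in s.
Proof.
move=> x0 kr; have s0 := side_gt0 (R := R) k.
pose i := cell k x; pose P := (Num.truncn (r * (ncell k)%:R)).+1.
have r0 : 0 <= r by apply: le_trans kr; rewrite divr_ge0// ltW.
have rP : r < P%:R * side k.
  rewrite -ltr_pdivrMr// invrK; exact: truncnS_gt.
have Pr : P%:R * side k <= r + side k.
  rewrite /P -natr1 mulrDl mul1r lerD2r -ler_pdivlMr// invrK.
  by rewrite truncn_le mulr_ge0.
exists (index_iota (i - P) (i + P).+1); split.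
  rewrite size_iota; apply: (@le_trans _ _ ((2 * P + 1)%:R * side k)).
    by rewrite ler_pM2r// ler_nat; lia.
  rewrite natrD natrM mulrDl mul1r -mulrA; lra.
move=> y y0; rewrite ltr_norml => /andP[h1 h2].
have /andP[x1 x2] := cell_itv k x0; have /andP[y1 y2] := cell_itv k y0.
rewrite mem_index_iota ltnS leq_subLR.
have lt_nat m n : m%:R * side k < n%:R * side k :> R -> (m < n)%N.
  by rewrite ltr_pM2r// ltr_nat.
rewrite -/i in x1 x2; apply/andP; split; rewrite -ltnS; apply: lt_nat.
  by rewrite -addnS natrD mulrDl; lra.
by rewrite -addSn natrD mulrDl; lra.
Qed.

(** On the line at height [h], the integrand is at most [a] on the set [A] of
    lifted points, of measure at most [42 * r / nchild k], and at most [b]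
    elsewhere. As [1 <= p], the smallness of the distance gives
    [b <= a / nchild k], so that both contributions are of the same order. *)
Lemma beta_fractal_le (p : R) z k r : 1 <= p -> fractal z ->
  side k / 4 <= r -> (forall j, (j < k)%N -> r < side j / 4) ->
  (beta (H1_on fractal) p z r <=
   ((84 / (nchild k)%:R) `^ p^-1 * (2 * side k / r))%:E)%E.
Proof.
move=> p1 Ez kr rj; have z0 := fractal_ge0 Ez.
have s0 := side_gt0 (R := R) k; have s1 := side_gt0 (R := R) k.+1.
have r0 : 0 < r by apply: lt_le_trans kr; rewrite divr_gt0.
have p0 : 0 < p by lra.
have N0 : 0 < (nchild k)%:R :> R by rewrite ltr0n nchild_gt0.
have N1 : 1 <= (nchild k)%:R :> R by rewrite ler1n nchild_gt0.
set h := height k (z ord0 ord0).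
have [s [ss near]] := near_cells z0 kr.
pose s' := [seq (i * nchild k + mid k)%N | i <- s].
pose A : set (plane R) := fractal `&` [set w | cell k.+1 (w ord0 ord0) \in s'].
pose B : set (plane R) := fractal `&` [set w | cell k (w ord0 ord0) \in s].
pose a := (2 * side k / r) `^ p; pose b := (2 * side k.+1 / r) `^ p.
have c0 : 0 <= 2 * side k / r.
  by apply: divr_ge0; [apply: mulr_ge0 => //; exact: ltW|exact: ltW].
have a0 : 0 <= a by exact: powR_ge0.
have b0 : 0 <= b by exact: powR_ge0.
have bE : b <= a / (nchild k)%:R.
  have -> : b = a * ((nchild k)%:R^-1) `^ p.
    rewrite /b -powRM ?invr_ge0 ?(ltW N0)//.
    suff -> : 2 * side k.+1 / r = 2 * side k / r * (nchild k)%:R^-1 by [].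
    by rewrite -(sideS k); field; rewrite !gt_eqF.
  by rewrite ler_wpM2l// ge1r_powR// invr_gt0 N0 invf_le1.
have mA : (H1_on fractal A <= (42 * r / (nchild k)%:R)%:E)%E.
  apply: (@le_trans _ _ (H1 R A)); first by apply: le_outer_measure; exact: subIsetl.
  apply: le_trans (H1_fractal_cells _ _) _; rewrite lee_fin size_map.
  by rewrite ler_pdivlMr// -!mulrA sideS; lra.
have mB : (H1_on fractal B <= (42 * r)%:E)%E.
  apply: (@le_trans _ _ (H1 R B)); first by apply: le_outer_measure; exact: subIsetl.
  by apply: le_trans (H1_fractal_cells _ _) _; rewrite lee_fin; lra.
pose I := (\int[cara_measure (H1_on fractal)]_(y in eball z r)
  (((dist_set y (hline h) / r) `^ p)%R)%:E)%E.
apply: (@le_trans _ _ ((r^-1%:E * I) `^ p^-1)%E).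
  by apply: ereal_inf_lbound; exists (hline h) => //; exact: is_line_hline.
have I0 : (0 <= I)%E by apply: integral_ge0 => y _; rewrite lee_fin; exact: powR_ge0.
have int_le : (I <= a%:E * H1_on fractal A + b%:E * H1_on fractal B)%E.
  apply: (@le_integral_two_steps _ _ _ (cara_measure (H1_on fractal))
    _ A B (~` fractal)) => //.
  - exact/caratheodory_restr/measurable_fractal_cells.
  - exact/caratheodory_restr/measurable_fractal_cells.
  - apply: measurableC; apply/caratheodory_restr; exact: measurable_fractal.
  - by rewrite /= /outer_restr setICl outer_measure0.
  - by move=> w _; rewrite lee_fin powR_ge0.
  move=> w; rewrite /eball/= => zw /contrapT Ew; have w0 := fractal_ge0 Ew.
  have hw : h = height k (w ord0 ord0).
    by apply: height_near => // j jk; exact: lt_trans zw (rj j jk).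
  have Bw : B w.
    by split => //; apply: near => //; exact: le_lt_trans (normr_le_edist _ _ _) zw.
  have le_pow c : 0 <= c -> `|w ord0 ord_max - h| <= c ->
      (dist_set w (hline h) / r) `^ p <= (c / r) `^ p.
    move=> cge0 wc; apply: ge0_ler_powR; rewrite ?nnegrE ?(ltW p0) ?divr_ge0 ?dist_hline_ge0 ?(ltW r0)//.
    by rewrite ler_pM2r ?invr_gt0//; exact: le_trans (dist_hline _ _) wc.
  rewrite lee_fin [X in _ <= _ + b * X]indicE (mem_set Bw) mulr1.
  have [lw|lw] := boolP (lifted k (w ord0 ord0)).
    have Aw : A w.
      split => //=; apply/mapP; exists (cell k (w ord0 ord0)); first exact: Bw.2.
      by rewrite (cell_child k w0) (eqP lw).
    rewrite indicE (mem_set Aw) mulr1.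
    suff : (dist_set w (hline h) / r) `^ p <= a by lra.
    apply: le_pow; first lra.
    have /andP[] := Ew.2 k; rewrite -hw => ? ?; rewrite ger0_norm; lra.
  suff : (dist_set w (hline h) / r) `^ p <= b.
    move/le_trans; apply; rewrite lerDr mulr_ge0//.
  apply: le_pow; first lra.
  have /andP[] := Ew.2 k.+1; rewrite heightS (negbTE lw) mul0r addr0 -hw => ? ?.
  by rewrite ger0_norm; lra.
have -> : (84 / (nchild k)%:R) `^ p^-1 * (2 * side k / r) =
    (84 / (nchild k)%:R * a) `^ p^-1.
  have n0 : 0 <= 84 / (nchild k)%:R :> R by apply: divr_ge0 => //; exact: ltW.
  rewrite [RHS]powRM//.
  by rewrite /a -powRrM mulfV ?gt_eqF// powRr1.
rewrite -poweR_EFin; apply: gt0_ler_poweR.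
- by rewrite invr_ge0 ltW.
- by rewrite in_itv/= leey andbT mule_ge0// lee_fin invr_ge0 ltW.
- by rewrite in_itv/= leey andbT lee_fin mulr_ge0// divr_ge0// ltW.
move: (I) I0 int_le => {}I I0 int_le.
have le1 : (a%:E * H1_on fractal A + b%:E * H1_on fractal B <=
    (a * (42 * r / (nchild k)%:R) + a / (nchild k)%:R * (42 * r))%:E)%E.
  rewrite EFinD; apply: leeD.
    by rewrite EFinM lee_pmul.
  rewrite EFinM; apply: lee_pmul => //; exact: outer_measure_ge0.
apply: (@le_trans _ _ (r^-1%:E * (a * (42 * r / (nchild k)%:R) + a / (nchild k)%:R * (42 * r))%:E)%E).
  by rewrite lee_pmul2l ?lte_fin ?invr_gt0//; exact: le_trans int_le le1.
rewrite -EFinM lee_fin le_eqVlt; apply/orP; left; apply/eqP.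
by field; rewrite !gt_eqF.
Qed.

End beta_estimate.

(** * Integrals and series for the square function *)

Section radial_integral.
Context {R : realType}.
Local Notation mu := (@lebesgue_measure R).

Lemma continuous_inv_cube (a : R) : 0 < a ->
  {within `[a, 1], continuous (fun r : R => r^-1 ^+ 3)}.
Proof.
move=> a0; apply: continuous_in_subspaceT => x; rewrite inE/= in_itv/= => /andP[ax _].
apply: (@continuous_comp _ _ _ (fun r : R => r^-1) (fun y => y ^+ 3)).
  by apply: inv_continuous; rewrite gt_eqF// (lt_le_trans a0).
exact: exprn_continuous.
Qed.

Lemma integral_inv_cube (a : R) : 0 < a < 1 ->
  (\int[mu]_(r in `[a, 1%R]) ((r^-1) ^+ 3)%:E <= (a^-1 ^+ 2 / 2)%:E)%E.
Proof.
move=> /andP[a0 a1]; pose F (r : R) : R := - 2^-1 *: (r^-1 ^+ 2 : R).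
have pos (x : R) : x \in `[a, (1 : R)] -> x != 0.
  by rewrite in_itv/= => /andP[ax _]; rewrite gt_eqF// (lt_le_trans a0).
have dF (x : R) : x != 0 -> is_derive x 1 F (x^-1 ^+ 3).
  move=> x0; have d1 := @is_deriveV R id x 1 1 x0 (is_derive_id x 1).
  have d2 := is_deriveX 2 d1; have d3 := is_deriveZ (- 2^-1) d2.
  have -> : x^-1 ^+ 3 = - 2^-1 *: ((2%:R * (id x)^-1 ^+ 1) *: (- (id x) ^- 2 *: (1 : R))).
    by rewrite /GRing.scale/=; field.
  exact: d3.
have cF (x : R) : x != 0 -> {for x, continuous F}.
  move=> x0; apply/differentiable_continuous/derivable1_diffP.
  exact: (@ex_derive _ _ _ _ _ _ _ (dF x x0)).
rewrite (@continuous_FTC2 _ (fun r => r^-1 ^+ 3) F)//.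
- rewrite -EFinB lee_fin /F /GRing.scale/= invr1 expr1n; lra.
- exact: continuous_inv_cube.
- split.
  + move=> x xa; apply: (@ex_derive _ _ _ _ _ _ _ (dF x _)).
    by apply: pos; exact: subset_itv_oo_cc xa.
  + by apply: cvg_at_right_filter; apply: cF; rewrite gt_eqF.
  + by apply: cvg_at_left_filter; apply: cF; rewrite oner_eq0.
- move=> x xa; rewrite derive1E.
  by apply: (@derive_val _ _ _ _ _ _ _ (dF x _)); apply: pos; exact: subset_itv_oo_cc xa.
Qed.

(** The mean value inequality for the power [- u], obtained from
    [1 + t <= expR t] and [ln (1 + t) <= t]. *)
Lemma powR_telescope (u : R) k : 0 < u ->
  u * (k.+2%:R `^ (u + 1))^-1 <= (k.+1%:R `^ u)^-1 - (k.+2%:R `^ u)^-1.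
Proof.
move=> u0; set x : R := k.+1%:R; set y : R := k.+2%:R.
have x0 : 0 < x by rewrite ltr0n.
have y0 : 0 < y by rewrite ltr0n.
have yx : x = y - 1 by rewrite /x /y -(natr1 k.+1) addrK.
have yE : y `^ (u + 1) = y `^ u * y.
  rewrite powRD ?powRr1 ?(ltW y0)//.
  by apply/implyP => _; rewrite gt_eqF.
have ypos : 0 < y `^ u by exact: powR_gt0.
have xpos : 0 < x `^ u by exact: powR_gt0.
have ratio : 1 + u / y <= y `^ u / x `^ u.
  have -> : y `^ u / x `^ u = expR (u * (ln y - ln x)).
    by rewrite /powR !gt_eqF// -expRN -expRD; congr expR; ring.
  apply: le_trans (expR_ge1Dx _); rewrite lerD2l ler_pM2l//.
  have : ln (1 + - y^-1) <= - y^-1.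
    apply: le_ln1Dx; rewrite ltrN2 invf_lt1// ltr1n.
    by [].
  have -> : 1 + - y^-1 = x / y by rewrite yx; field; rewrite gt_eqF.
  by rewrite ln_div ?posrE// lerNr opprB.
have -> : u * (y `^ (u + 1))^-1 = u / y * (y `^ u)^-1.
  by rewrite yE; field; rewrite !gt_eqF.
have -> : (x `^ u)^-1 - (y `^ u)^-1 = (y `^ u / x `^ u - 1) * (y `^ u)^-1.
  by field; rewrite !gt_eqF.
by rewrite ler_pM2r ?invr_gt0// lerBrDl.
Qed.

Lemma powR_series_bounded (u : R) n : 0 < u ->
  \sum_(0 <= k < n) (k.+2%:R `^ (u + 1))^-1 <= u^-1.
Proof.
move=> u0.
suff : u * \sum_(0 <= k < n) (k.+2%:R `^ (u + 1))^-1 <= 1 - (n.+1%:R `^ u)^-1.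
  move=> h; rewrite -(ler_pM2l u0) mulfV ?gt_eqF//; apply: le_trans h _.
  by rewrite gerBl invr_ge0 powR_ge0.
elim: n => [|n IH]; first by rewrite big_geq// mulr0 powR1 invr1 subrr.
rewrite big_nat_recr//= mulrDr; have := powR_telescope n u0; lra.
Qed.

End radial_integral.

(** * The square function and the conclusion *)

Section square_function.
Context {R : realType}.
Local Notation mu := (@lebesgue_measure R).
Local Open Scope ereal_scope.

Lemma beta_ge0 (E : set (plane R)) (p : R) z r : 0 <= beta (H1_on E) p z r.
Proof. by apply: le_ereal_inf_tmp => _ [L _ <-]; exact: poweR_ge0. Qed.

(** For each radius [r] take the least [k] with [side k / 4 <= r]. The integrand
    is then at most [G k r], hence at most the sum of all the [G j r], which is
    measurable and can be integrated term by term. *)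
Lemma square_function_fractal (p : R) z : (1 <= p < 2)%R -> fractal z ->
  \int[mu]_(r in `]0%R, 1%R[) (beta (H1_on fractal) p z r ^+ 2 * r^-1%:E) < +oo.
Proof.
move=> /andP[p1 p2] Ez.
have p0 : (0 < p)%R by lra.
pose B k : R := ((84 / (nchild k)%:R) `^ p^-1)%R.
have B0 k : (0 <= B k)%R by exact: powR_ge0.
pose C k : R := (4 * B k ^+ 2 * side k ^+ 2)%R.
have C0 k : (0 <= C k)%R by apply: mulr_ge0; [apply: mulr_ge0 => //|]; exact: sqr_ge0.
pose J k : set R := `[(side k / 4)%R, 1%R]%classic.
pose G k : R -> \bar R := fun r => (C k * (r^-1 ^+ 3 * \1_(J k) r))%:E.
have s0 k : (0 < side k :> R)%R := side_gt0 k.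
have s1 k : (side k <= 1 :> R)%R by rewrite -side0; exact: side_anti.
have mJ k : measurable (J k) by exact: measurable_itv.
have restrG k : G k = (fun r => (C k)%:E * ((EFin \o (fun r => (r^-1 ^+ 3)%R)) \_ (J k)) r).
  apply/funext => r; rewrite /G patchE /= EFinM; congr (_ * _).
  by rewrite indicE; case: (r \in J k); rewrite ?mulr1 ?mulr0.
have cJ k r : J k r -> (0 < r)%R.
  by rewrite /J /= in_itv/= => /andP[+ _]; apply: lt_le_trans; rewrite divr_gt0.
have mcube k : measurable_fun (J k) (EFin \o (fun r : R => (r^-1 ^+ 3)%R)).
  apply/measurable_EFinP; apply: subspace_continuous_measurable_fun => //.
  by apply: continuous_inv_cube; rewrite divr_gt0.
have mG k : measurable_fun setT (G k).
  rewrite restrG; apply: measurable_funeM.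
  by apply/(measurable_restrictT _ _).1; [exact: mJ|exact: mcube].
have G0 k r : 0 <= G k r.
  rewrite /G indicE lee_fin; have [/[!inE] /cJ r0|_] := boolP (r \in J k).
    by rewrite mulr1 mulr_ge0// exprn_ge0// invr_ge0 ltW.
  by rewrite !mulr0.
have intG k : \int[mu]_r G k r <= (32 * B k ^+ 2)%:E.
  rewrite restrG ge0_integralZl//; last 3 first.
  - by apply/(measurable_restrictT _ _).1; [exact: mJ|exact: mcube].
  - move=> r _; rewrite patchE; case: ifPn => // /[!inE] /cJ r0.
    by rewrite lee_fin exprn_ge0// invr_ge0 ltW.
  - by rewrite lee_fin.
  rewrite -integral_mkcond.
  have s4 : (0 < (side k / 4 : R) < 1)%R.
    by rewrite divr_gt0//=; have := s1 k; have := s0 k; lra.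
  apply: (@le_trans _ _ ((C k)%:E * ((side k / 4)^-1 ^+ 2 / 2)%:E)).
    by apply: lee_wpmul2l; [rewrite lee_fin|exact: integral_inv_cube].
  rewrite -EFinM lee_fin /C le_eqVlt; apply/orP; left; apply/eqP.
  by field; rewrite gt_eqF.
have BE k : (B k ^+ 2 <= 84 ^+ 2 * (k.+2%:R `^ (2 / p - 1 + 1))^-1)%R.
  rewrite subrK /B -powR_mulrn ?powR_ge0// -powRrM [(p^-1 * _)%R]mulrC.
  rewrite powRM ?invr_ge0//.
  apply: ler_pM; rewrite ?powR_ge0//.
    rewrite -powR_mulrn//; apply: ler_powR; first by rewrite ler1n.
    by rewrite ler_pdivrMr// ler_peMr.
  rewrite -powR_inv1// -powRrM mulN1r powRN lef_pV2 ?posrE ?powR_gt0 ?ltr0n ?nchild_gt0//.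
  by apply: ge0_ler_powR; rewrite ?nnegrE ?divr_ge0// ?(ltW p0)// ler_nat /nchild; lia.
apply: (@le_lt_trans _ _ (\int[mu]_r (\sum_(k <oo) G k r))).
  apply: ge0_le_integral_nomeas.
  - move=> r /=; rewrite in_itv/= => /andP[r0 r1].
    by apply: mule_ge0; [apply: mule_ge0; exact: beta_ge0|rewrite lee_fin invr_ge0 ltW].
  - by move=> r; apply: nneseries_ge0 => k _ _; exact: G0.
  move=> r /=; rewrite in_itv/= => /andP[r0 r1].
  have exk : exists k, (side k / 4 <= r)%R.
    have r40 : (0 < 4 * r)%R by rewrite mulr_gt0.
    have [k /(_ k (leqnn k))] := side_le_eps r40.
    by move=> h; exists k; lra.
  case: (ex_minnP exk) => k kr kmin.
  have rj j : (j < k)%N -> (r < side j / 4)%R.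
    by move=> jk; rewrite ltNge; apply/negP => /kmin; rewrite leqNgt jk.
  have le := beta_fractal_le p1 Ez kr rj.
  apply: (@le_trans _ _ (G k r)).
    have Jr : J k r by rewrite /J /= in_itv/= kr ltW.
    have b0 := beta_ge0 fractal p z r.
    rewrite /G indicE (mem_set Jr) mulr1.
    apply: (@le_trans _ _ ((B k * (2 * side k / r))%:E * (B k * (2 * side k / r))%:E * r^-1%:E)).
      apply: lee_wpmul2r; first by rewrite lee_fin invr_ge0 ltW.
      exact: lee_pmul.
    rewrite -!EFinM lee_fin /C le_eqVlt; apply/orP; left; apply/eqP.
    by field; rewrite gt_eqF.
  rewrite (@nneseriesD1 _ (fun j => G j r) k)//.
  by apply: leeDl; apply: nneseries_ge0 => j _ _; exact: G0.
rewrite integral_nneseries//.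
apply: (@le_lt_trans _ _ (\sum_(k <oo) (32 * B k ^+ 2)%:E)).
  apply: lee_nneseries => [k _ _|k _]; last exact: intG.
  by apply: integral_ge0.
apply: (@le_lt_trans _ _ (32 * 84 ^+ 2 * (2 / p - 1)^-1)%:E); last exact: ltry.
apply: lime_le.
  by apply: is_cvg_nneseries => k _ _; rewrite lee_fin mulr_ge0// sqr_ge0.
apply: nearW => n; rewrite sumEFin lee_fin.
have u0 : (0 < 2 / p - 1)%R by rewrite subr_gt0 ltr_pdivlMr// mul1r.
apply: (@le_trans _ _ (\sum_(0 <= k < n) 32 * (84 ^+ 2 * (k.+2%:R `^ (2 / p - 1 + 1))^-1))%R).
  by apply: ler_sum => k _; rewrite ler_pM2l.
by rewrite -!mulr_sumr -mulrA !ler_pM2l// powR_series_bounded.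
Qed.

End square_function.

Local Open Scope ereal_scope.

Theorem theorem1p1 (R : realType) :
  exists E : set (plane R),
    [/\ (H1 R).-caratheodory E,
        0 < H1 R E < +oo,
        purely_unrectifiable E &
        forall p : R, (1 <= p < 2)%R ->
          {ae cara_measure (H1 R), forall x, E x ->
            \int[lebesgue_measure]_(r in `]0%R, 1%R[)
              (beta (H1_on E) p x r ^+ 2 * r^-1%:E) < +oo}].
Proof.
exists fractal; split.
- exact: measurable_fractal.
- by rewrite H1_fractal_gt0 H1_fractal_lt_pinfty.
- exact: fractal_purely_unrectifiable.
- by move=> p p12; apply: aeW => x Ex; exact: square_function_fractal.
Qed.
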